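(* Let $\eta\ge2$ be an integer, let $\mu=\eta$, let $\gamma>0$, let $\tilde\Delta_\infty(x)=\exp(\exp(x))$, let $f\in\mathcal B_{\tilde\Delta_\infty}$, and assume that $\rho\in\mathbb T^\infty$ satisfies the infinite-dimensional Diophantine condition with parameters $\gamma,\mu$. Then there exist $\upsilon>0$ and $C>0$, independent of $N$ and $T$, such that for all sufficiently large $N$ (integer) and $T$ (real) and all $\theta\in\mathbb T^\infty$ $$\left\|\overline{\mathrm{WB}}_N(f)(\theta)-\int_{\mathbb T^\infty}f(\hat\theta)\,d\hat\theta\right\|_{\mathcal B}\le C\exp\left(-N^{\upsilon}\right)$$ and $$\left\|\frac1T\int_0^T\bar w(t/T)\,f(\rho t+\theta)\,dt-\int_{\mathbb T^\infty}f(\hat\theta)\,d\hat\theta\right\|_{\mathcal B}\le C\exp\left(-T^{\upsilon}\right).$$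
   Context: $\mathbb N=\{0,1,2,\dots\}$, $\mathbb T^\infty=\mathbb T^{\mathbb N}$ with the product (normalized Lebesgue) probability measure; the set of rotation vectors $\rho$ is identified with the cube $[1,2]^{\mathbb N}$. For a fixed integer $\eta\ge2$, $$\mathbb Z_*^\infty=\Big\{k\in\mathbb Z^{\mathbb N}:\ |k|_\eta:=\sum_{j\in\mathbb N}\langle j\rangle^\eta|k_j|<+\infty\Big\},\qquad \langle j\rangle=\max\{1,|j|\},$$ so each such $k$ has finite support. The vector $\rho$ satisfies the infinite-dimensional Diophantine condition with parameters $\gamma>0$, $\mu>1$ if $$|k\cdot\rho-n|>\frac{\gamma}{\prod_{j\in\mathbb N}\left(1+|k_j|^\mu\langle j\rangle^\mu\right)}\qquad\text{for all } 0\ne k\in\mathbb Z_*^\infty,\ n\in\mathbb Z.$$ $(\mathcal B,\|\cdot\|_{\mathcal B})$ is a Banach (function) space, possibly infinite-dimensional, over complex scalars. $\mathcal B_{\tilde\Delta_\infty}$ is the set of $f:\mathbb T^\infty\to\mathcal B$ such that $f(\theta)=\sum_{k\in\mathbb Z_*^\infty}\hat f_k e^{2\pi i k\cdot\theta}$ for every $\theta$ (equality in the norm of $\mathcal B$), where $\hat f_k=\int_{\mathbb T^\infty}f(\hat\theta)e^{-2\pi i k\cdot\hat\theta}\,d\hat\theta$, and $\sup_{0\ne k\in\mathbb Z_*^\infty}\tilde\Delta_\infty(|k|_\eta)\,\|\hat f_k\|_{\mathcal B}<+\infty$. The weighting function is $$\bar w(x)=\left(\int_0^1\exp\left(-s^{-1}(1-s)^{-1}\right)ds\right)^{-1}\exp\left(-x^{-1}(1-x)^{-1}\right)\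 \text{ on }(0,1),\qquad \bar w(0)=\bar w(1)=0.$$ With $T_\rho(\theta)=\theta+\rho \bmod 1$ in each coordinate, $$\overline{\mathrm{WB}}_N(f)(\theta)=\frac1{A_N}\sum_{n=0}^{N-1}\bar w\!\left(\frac nN\right)f(T_\rho^n(\theta)),\qquad A_N=\sum_{n=0}^{N-1}\bar w\!\left(\frac nN\right).$$ *)

(* Defs.v *)
From HB Require Import structures.
From mathcomp Require Import all_boot all_order all_algebra.
From mathcomp Require Import all_classical all_reals all_analysis.
From mathcomp Require Export summability complex.

Set Implicit Arguments.
Unset Strict Implicit.
Unset Printing Implicit Defensive.

Import Order.TTheory GRing.Theory Num.Theory.
Import numFieldNormedType.Exports.

Local Open Scope classical_set_scope.
Local Open Scope ring_scope.
Local Open Scope complex_scope.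

Section Torus.
Variable R : realType.

(* The circle R/Z is represented by its fundamental domain [0, 1[. *)
Definition circle := {x : R | 0 <= x < 1}.

Lemma mod1_subproof (x : R) : 0 <= x - (Num.floor x)%:~R < 1.
Proof.
by rewrite subr_ge0 (floor_le x) ltrBlDl -(intrD1 (Num.floor x)) floorD1_gt.
Qed.

Definition mod1 (x : R) : circle := 
  exist (fun y : R => is_true (0 <= y < 1)) _ (mod1_subproof x).

HB.instance Definition _ := Choice.on circle.
HB.instance Definition _ := isPointed.Build circle (mod1 0).

Definition torus := nat -> circle.

HB.instance Definition _ := Pointed.on torus.

Definition torus_coord (j : nat) (theta : torus) : R := \val (theta j).

Definition torus_cylinders : set (set torus) :=
  \bigcup_j preimage_set_system setT (torus_coord j) measurable.

HB.instance Definition _ :=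
  Measurable.copy torus (g_sigma_algebraType torus_cylinders).

(* This characterizes the product of the normalized Lebesgue measures: the
   cylinders with finite-dimensional base form a pi-system generating the
   product sigma-algebra. *)
Definition is_torus_measure (mu : set torus -> \bar R) : Prop :=
  forall (n : nat) (A : nat -> set R), (forall j, measurable (A j)) ->
    mu [set theta | forall j, (j < n)%N -> A j (torus_coord j theta)] =
    (\prod_(j < n) lebesgue_measure (A j `&` `[0%R, 1%R[))%E.

(* On lifts rho in R^N: rotation vectors live in [1, 2]^N. *)
Definition rotation (rho : nat -> R) (theta : torus) : torus :=
  fun j => mod1 (torus_coord j theta + rho j).

Definition flow (rho : nat -> R) (t : R) (theta : torus) : torus :=
  fun j => mod1 (rho j * t + torus_coord j theta).

End Torus.

Section Bochner.
Context {R : realType} {B : completeNormedModType R[i]}.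

(* The library norm of a complex normed space takes its values in R[i]. *)
Definition bnorm (x : B) : R := complex.Re `|x|.

Context {d : measure_display} {T : measurableType d}.
Variables (mu : {measure set T -> \bar R}) (D : set T).

Definition simple_integrable (s : T -> B) : Prop :=
  [/\ finite_set (range s),
      forall b, measurable (D `&` s @^-1` [set b]) &
      forall b, b != 0 -> (mu (D `&` s @^-1` [set b]) < +oo)%E].

(* The value 0 is discarded: its level set may have infinite measure. *)
Definition simple_integral (s : T -> B) : B :=
  \sum_(b \in range s `\ 0) (fine (mu (D `&` s @^-1` [set b])))%:C *: b.

Definition bochner_approx (f : T -> B) (s : nat -> T -> B) : Prop :=
  [/\ forall n, simple_integrable (s n),
      {ae mu, forall x, D x -> (fun n => s n x) @ \oo --> f x} &
      (fun n => \int[mu]_(x in D) (bnorm (f x - s n x))%:E)%E @ \oo --> 0%E].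

Definition bochner_integrable (f : T -> B) : Prop :=
  exists s, bochner_approx f s.

Definition is_bochner_integral (f : T -> B) (I : B) : Prop :=
  exists2 s, bochner_approx f s &
    (fun n => simple_integral (s n)) @ \oo --> I.

(* By convention 0 when f is not Bochner integrable. *)
Definition bochner_integral (f : T -> B) : B :=
  xget 0 [set I | is_bochner_integral f I].

End Bochner.

Section Frequencies.
Variable R : realType.

Definition jap (j : nat) : nat := maxn 1 j.

Definition eta_norm (eta : nat) (k : nat -> int) : \bar R :=
  (\sum_(0 <= j <oo) (((jap j)%:R ^+ eta * `|k j|%:~R)%R : R)%:E)%E.

Definition Zstar (eta : nat) : set (nat -> int) :=
  [set k | (eta_norm eta k < +oo)%E].

(* Sum over the finite support of k. *)
Definition freq_dot (k : nat -> int) (x : nat -> R) : R :=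
  \sum_(j \in [set: nat]) (k j)%:~R * x j.

(* 0 `^ mu = 0 for mu != 0, so the factors with k j = 0 are equal to 1 and the
   product is over the finite support of k. *)
Definition diophantine (eta : nat) (gamma mu : R) (rho : nat -> R) : Prop :=
  forall k : nat -> int, Zstar eta k -> k != (fun=> 0) -> forall n : int,
    `|freq_dot k rho - n%:~R| >
    gamma / \big[*%R/1]_(j \in [set: nat])
              (1 + `|k j|%:~R `^ mu * (jap j)%:R `^ mu).

Definition e2pi (x : R) : R[i] := cos (2 * pi * x) +i* sin (2 * pi * x).

Definition torus_char (k : nat -> int) (theta : torus R) : R[i] :=
  e2pi (freq_dot k (fun j => torus_coord j theta)).

End Frequencies.

Section FourierSpace.
Context {R : realType} {B : completeNormedModType R[i]}.
Variable mu : {measure set (torus R) -> \bar R}.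

Definition fourier_integrand (f : torus R -> B) (k : nat -> int) :
    torus R -> B :=
  fun theta => torus_char (fun j => - k j) theta *: f theta.

Definition fourier_coef (f : torus R -> B) (k : nat -> int) : B :=
  bochner_integral mu setT (fourier_integrand f k).

(* The Fourier series converges in B, along the net of finite sets of
   frequencies, at every point; by the decay condition the order of summation
   is immaterial as soon as 1 / Delta(|k|_eta) is summable. *)
Definition fourier_space (eta : nat) (Delta : R -> R) (f : torus R -> B) :
    Prop :=
  [/\ forall k, Zstar R eta k ->
        bochner_integrable mu setT (fourier_integrand f k),
      forall theta,
        partial_sum (fun k : Zstar R eta =>
          torus_char (\val k) theta *: fourier_coef f (\val k)) @ totally
        --> f theta &
      (ereal_sup [set (Delta (fine (eta_norm R eta k)) *
                       bnorm (fourier_coef f k))%:E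
                 | k in Zstar R eta `\ (fun=> 0%Z)] < +oo)%E].

End FourierSpace.

Section WeightedBirkhoff.
Context {R : realType} {B : completeNormedModType R[i]}.

Definition wbar_raw (x : R) : R := expR (- (x^-1 * (1 - x)^-1)).

(* Extended by 0 outside ]0, 1[; only its values on [0, 1] are used. *)
Definition wbar (x : R) : R :=
  if 0 < x < 1 then
    (\int[lebesgue_measure]_(s in `]0, 1[) wbar_raw s)^-1 * wbar_raw x
  else 0.

Definition wb_sum (N : nat) : R := \sum_(n < N) wbar (n%:R / N%:R).

Definition wb_average (rho : nat -> R) (N : nat) (f : torus R -> B)
    (theta : torus R) : B :=
  (wb_sum N)^-1%:C *:
    \sum_(n < N) (wbar (n%:R / N%:R))%:C *: f (iter n (rotation rho) theta).

Definition wb_flow_integrand (rho : nat -> R) (T : R) (f : torus R -> B)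
    (theta : torus R) : R -> B :=
  fun t => (wbar (t / T))%:C *: f (flow rho t theta).

Definition wb_flow_average (rho : nat -> R) (T : R) (f : torus R -> B)
    (theta : torus R) : B :=
  T^-1%:C *: bochner_integral lebesgue_measure `[0, T]
               (wb_flow_integrand rho T f theta).

End WeightedBirkhoff.

(* Main.v *)
Require Import Defs.
From HB Require Import structures.
From mathcomp Require Import all_boot all_order all_algebra.
From mathcomp Require Import all_classical all_reals all_analysis.
From mathcomp Require Import finmap measurable_realfun.
From mathcomp Require Import ring lra zify.
Set Implicit Arguments.
Unset Strict Implicit.
Unset Printing Implicit Defensive.
Import Order.TTheory GRing.Theory Num.Theory.
Import numFieldNormedType.Exports.
Local Open Scope classical_set_scope.
Local Open Scope ring_scope.
Local Open Scope complex_scope.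

(** Subtracting the mean coefficient and inserting the Fourier series, the error
of a weighted average over M points is a sum over the frequencies k <> 0 of
fhat k times the exponential sum (1/M) sum_(n < M) w(n/M) z_k^n, where z_k is
the value of the k-th character on one step of the orbit. Two effects make
every term tiny.

Cancellation. The bump w(x) = exp(-1/x - 1/(1-x)) is of Gevrey class: its m-th
difference of step h is at most (4h)^m (2m)! ([iter_bdiff_flat_pair_le]). Since
the bump vanishes outside ]0, 1[, m summations by parts turn the factor
(1 - z)^m into such a difference, and optimizing m gives a mean of size at most
8 exp(- sqrt q / 8) as soon as q <= M |1 - z| ([norm_bump_sum_exp]).

Small divisors against decay. As 1 + a^eta <= exp(eta a), the Diophantine
condition with mu = eta yields
|k . rho - n| >= gamma exp(- eta |k|_eta) ([dioph_lower]). The coefficients are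
at most K exp(-exp |k|_eta). If |k|_eta <= ln X / (2 eta), the divisor is at
least gamma X^(-1/2) and the exponential sum is small; otherwise the coefficient
itself is at most exp(-exp(|k|_eta)/2) exp(-X^u), with u = 1/(4 eta)
([decay_tradeoff]). What remains, exp(-exp(|k|_eta)/2), is summable over all
frequencies because a frequency can be coded injectively by an integer at most
exponential in |k|_eta ([Zstar_sum_le]).

The continuous average is a limit of discrete ones. The integrand is Lipschitz
in time, so it is Bochner integrable and its integral is the limit of its
Riemann sums ([bochner_integral_lipschitz]); a Riemann sum with M points is a
weighted average along the orbit with time step T/M, to which the discrete
estimate applies with |1 - z_k| >= T |k . rho| / M, uniformly in large M.

Fourier series are summed along the net of finite sets of frequencies, so only
bounds that are uniform over finite partial sums are required. *)

(** * Finite differences of the flat functions *)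

Section Bump.
Variable R : realType.
Implicit Types (x h : R) (i j m : nat).

(** One term of the exponential series: x^i / i! <= exp x. *)
Lemma exprM_expRN_le i x : 0 <= x -> x ^+ i * expR (- x) <= i`!%:R.
Proof.
move=> x0; rewrite expRN ler_pdivrMr ?expR_gt0//.
case: i => [|i]; first by rewrite expr0 mul1r -[leLHS]expR0 ler_expR.
have := expR_ge1Dxn i x0 => H.
rewrite mulrC -ler_pdivrMr ?ltr0n ?fact_gt0//.
by apply: le_trans H; rewrite ler_wpDl.
Qed.

(** The derivatives of exp(-1/x) are integer combinations of these functions,
which makes the family closed under differentiation. *)
Definition flat i x : R := if 0 < x then x^-1 ^+ i * expR (- x^-1) else 0.

Lemma flat_ge0 i x : 0 <= flat i x.
Proof.
rewrite /flat; case: ifP => // x0.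
by rewrite mulr_ge0 ?expR_ge0// exprn_ge0// invr_ge0 ltW.
Qed.

Lemma flat_le i x : flat i x <= i`!%:R.
Proof.
rewrite /flat; case: ifP => [x0|_]; last by rewrite ler0n.
by rewrite exprM_expRN_le// invr_ge0 ltW.
Qed.

(** This factorization exhibits [flat i.+1] as the slope of [flat i] at 0, so that
differentiability at 0 reduces to continuity. *)
Lemma flatS i x : flat i x = x * flat i.+1 x.
Proof.
rewrite /flat; case: ifP => [x0|_]; last by rewrite mulr0.
by rewrite exprS !mulrA divff ?mul1r// gt_eqF.
Qed.

Lemma flat_cvg0 i : flat i x @[x --> (0:R)] --> (0 : R).
Proof.
apply/cvgrPdist_le => e e0; near=> x.
rewrite sub0r normrN flatS normrM (ger0_norm (flat_ge0 _ _)).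
apply: (@le_trans _ _ (`|x| * (i.+1)`!%:R)).
  by rewrite ler_wpM2l// flat_le.
rewrite -ler_pdivlMr ?ltr0n ?fact_gt0//.
near: x; apply: (@nbhs0_le _ R^o); by rewrite divr_gt0 ?ltr0n ?fact_gt0.
Unshelve. all: by end_near. Qed.

Lemma is_derive_flat i x :
  is_derive x (1:R) (flat i) (flat i.+2 x - i%:R * flat i.+1 x).
Proof.
have [x0|x0|->] := ltgtP x 0.
- rewrite /flat !ltNge (ltW x0)/= mulr0 subr0.
  apply: (@near_eq_is_derive _ _ _ (cst 0)).
  near=> y; rewrite ltNge ifF//; apply/negbF/ltW.
  by near: y; exact: lt_nbhsl.
- have fE : \forall y \near x, y^-1 ^+ i * expR (- y^-1) = flat i y.
    near=> y; rewrite /flat ifT//.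
    by near: y; exact: lt_nbhsr.
  suff H : is_derive x (1:R) (fun y => y^-1 ^+ i * expR (- y^-1))
      (flat i.+2 x - i%:R * flat i.+1 x).
    exact: near_eq_is_derive fE H.
  have xn0 : x != 0 by rewrite gt_eqF.
    have dV : is_derive x (1:R) (fun y : R => y^-1) (- x ^- 2).
      have := is_deriveV xn0 (is_derive_id x (1:R)).
      by rewrite /GRing.scale/= mulr1.
    have dN : is_derive x (1:R) (fun y : R => - y^-1) (x ^- 2).
      by have := @is_deriveN _ _ _ _ _ _ _ dV; rewrite opprK.
    have dE := @is_derive1_comp _ expR _ x _ _ (is_derive_expR (- x^-1)) dN.
    have dX := @is_deriveX _ _ _ i _ _ _ dV.
    have dM := is_deriveM dX dE.
    rewrite (_ : (fun y : R => _) = (fun y : R => y^-1) ^+ i * (expR \o (fun y => - y^-1))); last first.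
      by apply/funext => y; rewrite mulrfctE exprfctE.
    apply: (is_derive_eq dM).
    rewrite /flat x0 /GRing.scale/=.
    rewrite exprfctE !exprVn.
    case: i {dX dM fE} => [|i]; rewrite /= ?exprS ?expr0; field => //.
    by rewrite expf_neq0.
- have flat0 n : flat n 0 = 0 by rewrite /flat ltxx.
  rewrite !flat0 mulr0 subr0.
  apply/is_derive1_caratheodory; exists (flat i.+1); split=> //.
  + by move=> y; rewrite flat0 !subr0 mulrC -flatS.
  + by rewrite /prop_for /continuous_at flat0; exact: flat_cvg0.
Unshelve. all: by end_near. Qed.

(** [flat_pair 0 0] is exp(-1/x - 1/(1 - x)) on ]0, 1[ and 0 elsewhere, that is, the
weight before normalization; the other members occur in its derivatives. *)
Definition flat_pair i j x : R := flat i x * flat j (1 - x).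

Lemma flat_pair_le i j x : `|flat_pair i j x| <= ((i + j)`!)%:R.
Proof.
rewrite /flat_pair normrM !ger0_norm ?flat_ge0//.
apply: (@le_trans _ _ (i`!%:R * j`!%:R)); first by rewrite ler_pM ?flat_ge0// flat_le.
rewrite -natrM ler_nat -[X in (_ <= X)%N](bin_fact (leq_addr j i)) addKn.
by rewrite leq_pmull// bin_gt0 leq_addr.
Qed.

Lemma is_derive_flat_pair i j x : is_derive x (1:R) (flat_pair i j)
  (flat_pair i.+2 j x - i%:R * flat_pair i.+1 j x - flat_pair i j.+2 x + j%:R * flat_pair i j.+1 x).
Proof.
have d1 : is_derive x (1:R) (fun y : R => 1 - y) (-1).
  have := @is_deriveB _ _ _ _ _ _ _ _ _ (is_derive_cst (1:R) x (1:R)) (is_derive_id x (1:R)).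
  by rewrite sub0r.
have d2 := @is_derive1_comp _ _ _ x _ _ (is_derive_flat j (1 - x)) d1.
have dM : is_derive x (1:R) (flat_pair i j) _ := is_deriveM (is_derive_flat i x) d2.
apply: (is_derive_eq dM); rewrite /flat_pair /GRing.scale/=; ring.
Qed.

Definition bdiff h (F : R -> R) x := F x - F (x - h).

Lemma iter_bdiff_lin h m (F G H K : R -> R) (a b : R) x :
  iter m (bdiff h) (fun y => F y - a * G y - H y + b * K y) x =
  iter m (bdiff h) F x - a * iter m (bdiff h) G x - iter m (bdiff h) H x +
  b * iter m (bdiff h) K x.
Proof. by elim: m x => [//|m IH] x; rewrite /= /bdiff !IH; ring. Qed.

Lemma is_derive_iter_bdiff h m (F F' : R -> R) :
  (forall x, is_derive x (1:R) F (F' x)) ->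
  forall x, is_derive x (1:R) (iter m (bdiff h) F) (iter m (bdiff h) F' x).
Proof.
move=> dF; elim: m => [//|m IH] x.
have d1 : is_derive x (1:R) (fun y : R => y - h) 1.
  have := @is_deriveB _ _ _ _ _ _ _ _ _ (is_derive_id x (1:R)) (is_derive_cst h x (1:R)).
  by rewrite subr0.
have d2 := @is_derive1_comp _ _ _ x _ _ (IH (x - h)) d1.
have dB : is_derive x (1:R) (iter m.+1 (bdiff h) F) _ :=
  @is_deriveB _ _ _ _ _ _ _ _ _ (IH x) d2.
by apply: (is_derive_eq dB); rewrite mulr1.
Qed.

(** By the mean value theorem a difference of order m + 1 is h times a difference of
order m of the derivative, which consists of four members of the family whose
indices grow by at most two. *)
Lemma iter_bdiff_flat_pair_le h m i j x : 0 <= h ->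
  `|iter m (bdiff h) (flat_pair i j) x| <= (4 * h) ^+ m * ((i + j + m.*2)`!)%:R.
Proof.
move=> h0; elim: m i j x => [|m IH] i j x.
  by rewrite expr0 mul1r double0 addn0 flat_pair_le.
have dG := @is_derive_iter_bdiff h m _ _ (is_derive_flat_pair i j).
set G := iter m _ (flat_pair i j) in dG.
rewrite -[iter m.+1 _ _ _]/(G x - G (x - h)).
have [||c _ ->] := @MVT_segment R G (iter m (bdiff h) (fun y => flat_pair i.+2 j y -
  i%:R * flat_pair i.+1 j y - flat_pair i j.+2 y + j%:R * flat_pair i j.+1 y)) (x - h) x.
- by rewrite gerBl.
- apply: continuous_subspaceT => y; apply: differentiable_continuous.
  by apply/derivable1_diffP; have [] := dG y.
rewrite opprB addrC subrK normrM (ger0_norm h0) iter_bdiff_lin.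
set a := (i + j + m.+1.*2)`!%:R.
have fle p n : (n <= p.+1)%N -> n%:R * (p`!)%:R <= (p.+1)`!%:R :> R.
  by move=> np; rewrite -natrM ler_nat factS leq_mul.
have b1 : `|iter m (bdiff h) (flat_pair i.+2 j) c| <= (4 * h) ^+ m * a.
  by rewrite (le_trans (IH _ _ _))// /a doubleS !addnS !addSn.
have b3 : `|iter m (bdiff h) (flat_pair i j.+2) c| <= (4 * h) ^+ m * a.
  by rewrite (le_trans (IH _ _ _))// /a doubleS !addnS !addSn.
have p0 : 0 <= (4 * h) ^+ m by rewrite exprn_ge0// mulr_ge0.
have b2 : `|i%:R * iter m (bdiff h) (flat_pair i.+1 j) c| <= (4 * h) ^+ m * a.
  rewrite normrM normr_nat (le_trans (ler_wpM2l _ (IH _ _ _)))// mulrCA ler_wpM2l//.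
  by rewrite /a doubleS ?addSn !addnS fle//; lia.
have b4 : `|j%:R * iter m (bdiff h) (flat_pair i j.+1) c| <= (4 * h) ^+ m * a.
  rewrite normrM normr_nat (le_trans (ler_wpM2l _ (IH _ _ _)))// mulrCA ler_wpM2l//.
  by rewrite /a doubleS ?addSn !addnS fle//; lia.
rewrite exprS -mulrA [leRHS](_ : _ = 4 * ((4 * h) ^+ m * a) * h); last by ring.
rewrite ler_wpM2r//.
apply: (le_trans (ler_normD _ _)); apply: (le_trans (lerD (ler_normB _ _) (lexx _))).
apply: (le_trans (lerD (lerD (ler_normB _ _) (lexx _)) (lexx _))).
lra.
Qed.
End Bump.

(** * Weighted exponential sums *)

Section ExpSum.
Variable R : realType.
Implicit Types (x h q : R) (m n M L : nat) (z : R[i]).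

Definition wbump : R -> R := flat_pair 0 0.

Lemma wbump_le0 x : x <= 0 -> wbump x = 0.
Proof. by move=> x0; rewrite /wbump /flat_pair /flat ltNge x0 mul0r. Qed.

Lemma wbump_ge1 x : 1 <= x -> wbump x = 0.
Proof. by move=> x1; rewrite /wbump /flat_pair [flat 0 (1 - x)]/flat subr_gt0 ltNge x1 mulr0. Qed.

Lemma wbump_ge0 x : 0 <= wbump x.
Proof. by rewrite /wbump /flat_pair mulr_ge0 ?flat_ge0. Qed.

Lemma wbump_le1 x : wbump x <= 1.
Proof. by have := flat_pair_le 0 0 x; rewrite ger0_norm// wbump_ge0. Qed.

Lemma iter_bdiff_bump_le0 h m x : 0 <= h -> x <= 0 -> iter m (bdiff h) wbump x = 0.
Proof.
move=> h0; elim: m x => [|m IH] x x0; first exact: wbump_le0.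
by rewrite /= /bdiff !IH ?subrr//; lra.
Qed.

Lemma iter_bdiff_bump_ge1 h m x : 0 <= h -> 1 + m%:R * h <= x -> iter m (bdiff h) wbump x = 0.
Proof.
move=> h0; elim: m x => [|m IH] x x1; first by apply: wbump_ge1; lra.
rewrite /= /bdiff !IH ?subrr//; move: x1; rewrite -natr1; lra.
Qed.

(** Summation by parts; the two vanishing conditions cancel the boundary terms. *)
Lemma sum_bdiff_abel h (F : R -> R) z L : F (- h) = 0 -> F (L%:R * h) = 0 ->
  \sum_(n < L.+1) (bdiff h F (n%:R * h))%:C * z ^+ n =
  (1 - z) * \sum_(n < L) (F (n%:R * h))%:C * z ^+ n.
Proof.
move=> F0 FL.
under eq_bigr do rewrite /bdiff rmorphB mulrBl.
rewrite sumrB big_ord_recr/= FL rmorph0 mul0r addr0 mulrBl mul1r; congr (_ - _).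
rewrite big_ord_recl/= mul0r sub0r F0 rmorph0 mul0r add0r mulr_sumr.
apply: eq_bigr => i _; rewrite /fintype.bump add1n exprS mulrCA; congr (_ * (_ * _)).
by rewrite -natr1 (_ : _ - h = i%:R * h)//; ring.
Qed.

(** Each difference widens the support by one grid step, hence the range M + m. *)
Lemma sum_iter_bdiff_bump M m z : (0 < M)%N ->
  \sum_(n < M + m) (iter m (bdiff M%:R^-1) wbump (n%:R / M%:R))%:C * z ^+ n =
  (1 - z) ^+ m * \sum_(n < M) (wbump (n%:R / M%:R))%:C * z ^+ n.
Proof.
move=> M0; have M0' : 0 < M%:R :> R by rewrite ltr0n.
have h0 : 0 <= M%:R^-1 :> R by rewrite invr_ge0 ltW.
elim: m => [|m IH]; first by rewrite addn0 expr0 mul1r.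
rewrite addnS sum_bdiff_abel.
- by rewrite IH exprS mulrA.
- by apply: iter_bdiff_bump_le0; rewrite ?oppr_le0.
- by apply: iter_bdiff_bump_ge1; rewrite ?natrD ?mulrDl ?divff ?gt_eqF.
Qed.

Lemma leq_fact_exp n : (n`! <= n ^ n)%N.
Proof.
have H m : (m <= n -> m`! <= n ^ m)%N.
  by elim: m => [//|m IH] mn; rewrite factS expnS leq_mul// IH// ltnW.
exact: H.
Qed.

Lemma norm_bump_sum_le M m z : (0 < M)%N -> `|z| = 1 ->
  `|1 - z| ^+ m * `|\sum_(n < M) (wbump (n%:R / M%:R))%:C * z ^+ n| <=
  ((M + m)%:R * ((4 / M%:R) ^+ m * (m.*2)`!%:R))%:C.
Proof.
move=> M0 z1; rewrite -normrX -normrM -sum_iter_bdiff_bump//.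
apply: (le_trans (ler_norm_sum _ _ _)).
rewrite [leRHS](_ : _ = \sum_(n < M + m) ((4 / M%:R) ^+ m * (m.*2)`!%:R)%:C); last first.
  by rewrite sumr_const card_ord -rmorphMn/= mulr_natl.
apply: ler_sum => n _; rewrite normrM normrX z1 expr1n mulr1.
rewrite normc_def/= expr0n addr0 sqrtr_sqr lecR.
by rewrite (le_trans (iter_bdiff_flat_pair_le _ _ _ _ _))// invr_ge0 ler0n.
Qed.

(** Norms of complex spaces are valued in the complex numbers; this turns them into
real numbers. *)
Lemma ge0_ReE (c : R[i]) : 0 <= c -> c = (complex.Re c)%:C.
Proof. by move=> /ger0_real /RRe_real ->. Qed.

Lemma expR1_le4 : expR 1 <= 4 :> R.
Proof.
have := expR_ge1Dx (- (2^-1) : R).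
rewrite expRN -[leRHS]div1r ler_pdivlMr ?expR_gt0// => h.
have -> : 1 = 2%:R * 2^-1 :> R by rewrite divff.
rewrite expRM_natl.
have := expR_gt0 (2^-1 : R); nra.
Qed.

(** The bound of order m has size (16 m^2 / q)^m; taking m close to sqrt q / 8 makes
the base at most 1/4 < 1/e. *)
Lemma norm_bump_sum_exp M q z : (0 < M)%N -> `|z| = 1 -> 0 <= q ->
  q%:C <= M%:R * `|1 - z| ->
  `|\sum_(n < M) (wbump (n%:R / M%:R))%:C * z ^+ n| <=
  (M%:R * (8 * expR (- (Num.sqrt q / 8))))%:C.
Proof.
move=> M0 z1 q0.
have M0' : 0 < M%:R :> R by rewrite ltr0n.
have := norm_bump_sum_le (Num.truncn (Num.sqrt q / 8)) M0 z1.
have z2 : `|1 - z| <= 2%:R.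
  by rewrite (le_trans (ler_normB _ _))// z1 normr1.
(* The order of summation by parts: 64 m^2 <= q < 64 (m + 1)^2. *)
set m := Num.truncn _; set S := \sum_(n < M) _.
rewrite (ge0_ReE (normr_ge0 (1 - z))) in z2 *; rewrite (ge0_ReE (normr_ge0 S)).
set r := complex.Re _ in z2 *; set s := complex.Re _.
have r0 : 0 <= r by rewrite -ler0c -ge0_ReE.
have s0 : 0 <= s by rewrite -ler0c -ge0_ReE.
rewrite -!(rmorphXn, rmorphM, rmorph_nat (real_complex R))/= !lecR in z2 * => H qr.
have /andP[m1 m2] : m%:R <= Num.sqrt q / 8 < m.+1%:R.
  by apply: truncn_itv; rewrite divr_ge0// sqrtr_ge0.
have mq : 64 * m%:R ^+ 2 <= q.
  rewrite -[leRHS](sqr_sqrtr q0).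
  have := sqrtr_ge0 q; move: m1; rewrite ler_pdivlMr//; have : 0 <= m%:R :> R by [].
  nra.
(* The trivial bound |1 - z| <= 2 gives q <= 2 M, hence m <= M and M + m <= 2 M. *)
have mM : m%:R <= M%:R :> R.
  have [->//|m0] := posnP m.
  have : 1 <= m%:R :> R by rewrite ler1n.
  nra.
have fm : (m.*2)`!%:R <= (4 * m%:R ^+ 2) ^+ m :> R.
  rewrite (le_trans (_ : _ <= (m.*2 ^ m.*2)%:R))//; first by rewrite ler_nat leq_fact_exp.
  rewrite natrX -mul2n exprM natrM (_ : (2%:R * m%:R) ^+ 2 = 4 * m%:R ^+ 2 :> R)//; ring.
have Hm : s <= M%:R * 2 * (4^-1) ^+ m.
  have [m0|m0] := posnP m.
    move: H; rewrite m0 !expr0 !mul1r double0 fact0 addn0 !mulr1 => H; nra.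
  have c0 : 0 < (64 * m%:R ^+ 2 / M%:R) ^+ m :> R.
    by rewrite exprn_gt0// divr_gt0// mulr_gt0// exprn_gt0// ltr0n.
  rewrite -(ler_pM2l c0) (le_trans (_ : _ <= r ^+ m * s))//.
    rewrite ler_wpM2r// lerXn2r ?nnegrE//.
    by rewrite ler_pdivrMr// (le_trans mq)// mulrC.
  rewrite (le_trans H)//.
  rewrite (le_trans (_ : _ <= (M%:R * 2) * ((4 / M%:R) ^+ m * (4 * m%:R ^+ 2) ^+ m)))//.
    rewrite ler_pM//.
    - by rewrite natrD; lra.
    - by rewrite ler_wpM2l// exprn_ge0// divr_ge0// ltW.
    rewrite [leRHS]mulrCA ler_wpM2l// ?mulr_ge0// -!exprMn.
  rewrite le_eqVlt; apply/orP; left; apply/eqP; congr (_ ^+ _); field.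
  by rewrite gt_eqF.
rewrite (le_trans Hm)// -mulrA (ler_wpM2l (ltW M0'))//.
have : (4^-1) ^+ m <= expR 1 * expR (- (Num.sqrt q / 8)) :> R.
  apply: (@le_trans _ _ (expR (- m%:R))).
    rewrite -[- _]mulrN1 expRM_natl expRN lerXn2r ?nnegrE ?invr_ge0 ?expR_ge0//.
    by rewrite lef_pV2 ?posrE ?expR_gt0// expR1_le4.
  by rewrite -expRD ler_expR; move: m2; rewrite -natr1; lra.
move=> h; have := ler_wpM2r (expR_ge0 (- (Num.sqrt q / 8))) expR1_le4.
move: h; set e := expR 1 * _; set e2 := expR (- _); set p := _ ^+ m.
lra.
Qed.
End ExpSum.

(** * The character of the circle *)

Section Circle.
Variable R : realType.
Implicit Types (x y : R).

Lemma e2piD x y : e2pi (x + y) = e2pi x * e2pi y.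
Proof.
rewrite /e2pi mulrDr cosD sinD; apply/eqP; rewrite eq_complex/=.
by apply/andP; split; apply/eqP; [|ring].
Qed.

Lemma e2pi0 : e2pi 0 = 1 :> R[i].
Proof. by rewrite /e2pi mulr0 cos0 sin0. Qed.

Lemma e2piN x : e2pi (- x) * e2pi x = 1.
Proof. by rewrite -e2piD addNr e2pi0. Qed.

Lemma e2piMn n x : e2pi (n%:R * x) = e2pi x ^+ n.
Proof.
elim: n => [|n IH]; first by rewrite mul0r e2pi0 expr0.
by rewrite -natr1 mulrDl mul1r e2piD IH exprSr.
Qed.

Lemma e2pi1 : e2pi 1 = 1 :> R[i].
Proof. by rewrite /e2pi mulr1 mulr_natl cos2pi sin2pi. Qed.

Lemma e2pi_int (n : int) : e2pi (n%:~R : R) = 1.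
Proof.
have Hn (m : nat) : e2pi (m%:R : R) = 1 by rewrite -[m%:R]mulr1 e2piMn e2pi1 expr1n.
case: n => n; first exact: Hn.
by have := e2piN (n.+1%:R : R); rewrite Hn mulr1 NegzE mulrNz.
Qed.

Lemma norm_e2pi x : `|e2pi x| = 1.
Proof. by rewrite normc_def/= cos2Dsin2 sqrtr1. Qed.

Lemma norm_1Be2pi x : `|1 - e2pi x| = (2 * `|sin (pi * x)|)%:C.
Proof.
rewrite normc_def/=; congr (_ %:C).
have s0 : 0 <= 2 * `|sin (pi * x)| by rewrite mulr_ge0.
rewrite -(ger0_norm s0) -sqrtr_sqr.
congr Num.sqrt; rewrite exprMn real_normK ?num_real//.
have -> : 2 * pi * x = (pi * x) *+ 2 by rewrite -mulrA mulr_natl.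
rewrite cos_mulr2n sin_mulr2n; have := cos2Dsin2 (pi * x).
set c := cos _; set s := sin _ => cs.
have -> : c ^+ 2 = 1 - s ^+ 2 by rewrite -cs; ring.
by transitivity (4 * s ^+ 2 * (c ^+ 2 + s ^+ 2)); [ring | rewrite cs; ring].
Qed.

Lemma sin_le_id y : 0 <= y -> sin y <= y.
Proof.
move=> y0; have [||c _] := @MVT_segment R sin cos 0 y => //.
  exact/continuous_subspaceT/continuous_sin.
by rewrite sin0 !subr0 => ->; rewrite ler_piMl// cos_le1.
Qed.

Lemma norm_1Be2pi_le x : `|1 - e2pi x| <= (8 * `|x|)%:C.
Proof.
rewrite norm_1Be2pi lecR.
have H : `|sin (pi * x)| <= pi * `|x|.
  wlog x0 : x / 0 <= x => [H|].
    have [|/ltW x0] := leP 0 x; first exact: H.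
    have := H (- x); rewrite oppr_ge0 mulrN sinN !normrN; exact.
  have p0 : 0 <= pi * x by rewrite mulr_ge0// pi_ge0.
  rewrite (ger0_norm x0) ler_norml sin_le_id// andbT.
  have := sin_le_id p0. 
  have [p1|p1] := leP (pi * x) pi.
    have := @sin_ge0_pi R (pi * x); rewrite p0 p1 => /(_ isT); lra.
  have := sin_geN1 (pi * x); have := pi_ge2 R; lra.
have := pihalf_lt2 R; have := normr_ge0 x; nra.
Qed.

(** Where cos(pi x) >= 1/2 the mean value theorem gives sin y >= y / 2 for y = pi |x|;
elsewhere sin y >= 1/2 already. *)
Lemma norm_1Be2pi_ge x : `|x| <= 2^-1 -> (`|x|)%:C <= `|1 - e2pi x|.
Proof.
move=> x2; rewrite norm_1Be2pi lecR.
have -> : `|sin (pi * x)| = `|sin (pi * `|x|)|.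
  by have [|] := ger0P x => // _; rewrite mulrN sinN normrN.
move: x2; set a := `|x| => a2; have a0 : 0 <= a by rewrite normr_ge0.
have pg := pi_ge2 R; set y := pi * a.
have y0 : 0 <= y by rewrite /y mulr_ge0//; lra.
have y1 : y <= pi / 2 by rewrite /y ler_wpM2l//; lra.
have s0 : 0 <= sin y by apply: sin_ge0_pi; rewrite y0/=; lra.
rewrite ger0_norm//.
have cs := cos2Dsin2 y.
have ay : a * 2 <= y by rewrite /y mulrC ler_wpM2r.
have [c2|c2] := leP (2^-1) (cos y).
  have [||c cy] := @MVT_segment R sin cos 0 y => //.
    exact/continuous_subspaceT/continuous_sin.
  rewrite sin0 !subr0 => sE.
  have cc : cos y <= cos c.
    move: cy; rewrite in_itv/= => /andP[c0]; rewrite le_eqVlt => /predU1P[->//|cy].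
    by rewrite ltW// ltr_cos// in_itv/=; lra.
  nra.
have c0 : 0 <= cos y by apply: cos_ge0_pihalf; lra.
nra.
Qed.
End Circle.

(** * Frequencies of finite weighted norm *)

Lemma fsbig_nat_ord (T : Type) (idx : T) (op : Monoid.com_law idx) (F : nat -> T) (J : nat) :
  (forall j, (J <= j)%N -> F j = idx) ->
  \big[op/idx]_(j \in [set: nat]) F j = \big[op/idx]_(j < J) F j.
Proof.
move=> FJ; rewrite -(big_mkord xpredT F).
have := fsbigE (op := op) (A := setT) (index_iota 0 J) F (iota_uniq _ _) _ _.
move=> -> //.
- by rewrite big_mkcond/=; apply: eq_bigr => j _; rewrite in_setT.
- by move=> j _; rewrite mem_index_iota/= -leqNgt => /FJ.
Qed.

Section Freq.
Variables (R : realType) (eta : nat).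
Implicit Types (k : nat -> int) (j J : nat).

Definition freq_norm k : R := fine (eta_norm R eta k).

Lemma freq_norm_term_ge0 k j : 0 <= (jap j)%:R ^+ eta * (`|k j|%:~R : R).
Proof. by rewrite mulr_ge0// ?exprn_ge0// ler0z. Qed.

Lemma Zstar_freq_normE k : Zstar R eta k -> eta_norm R eta k = (freq_norm k)%:E.
Proof.
move=> kZ; rewrite /freq_norm fineK// ge0_fin_numE//.
by apply: nneseries_ge0 => j _ _; rewrite lee_fin freq_norm_term_ge0.
Qed.

Lemma sum_le_freq_norm k J : Zstar R eta k ->
  \sum_(j < J) (jap j)%:R ^+ eta * (`|k j|%:~R : R) <= freq_norm k.
Proof.
move=> kZ; rewrite -lee_fin -Zstar_freq_normE// -sumEFin.
rewrite -(big_mkord xpredT (fun j => ((jap j)%:R ^+ eta * (`|k j|%:~R : R))%:E)).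
by apply: nneseries_lim_ge => j _ _; rewrite lee_fin freq_norm_term_ge0.
Qed.

Lemma freq_norm_ge0 k : Zstar R eta k -> 0 <= freq_norm k.
Proof. by move=> /(sum_le_freq_norm 0); rewrite big_ord0. Qed.

Hypothesis eta0 : (0 < eta)%N.

Lemma jap_gt0 j : (0 < jap j)%N. Proof. by rewrite leq_max. Qed.

Lemma jap_le_exp j : (jap j)%:R <= (jap j)%:R ^+ eta :> R.
Proof. by rewrite -[leLHS]expr1 ler_weXn2l// ler1n jap_gt0. Qed.

(** A nonzero k j with j > |k|_eta would alone contribute more than |k|_eta to the
norm, so the support lies below this integer, which moreover depends on the norm
only. *)
Definition supp_bound k : nat := (Num.truncn (freq_norm k)).+1.

Lemma supp_bound_le k : Zstar R eta k -> (supp_bound k)%:R <= freq_norm k + 1.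
Proof.
by move=> kZ; rewrite /supp_bound -natr1 lerD2r truncn_le freq_norm_ge0.
Qed.

Lemma supp_bound_eq0 k j : Zstar R eta k -> (supp_bound k <= j)%N -> k j = 0.
Proof.
move=> kZ; rewrite /supp_bound => Jj; apply/eqP; rewrite -absz_eq0 -leqn0 leqNgt; apply/negP => kj.
have := sum_le_freq_norm j.+1 kZ; rewrite big_ord_recr/= => H.
have jj : j%:R <= (jap j)%:R ^+ eta * (`|k j|%:~R : R).
  apply: (@le_trans _ _ ((jap j)%:R ^+ eta * 1)).
    by rewrite mulr1 (le_trans _ (jap_le_exp j))// ler_nat leq_maxr.
  by rewrite ler_wpM2l ?exprn_ge0// ler1z -abszE lez_nat.
have : 0 <= \sum_(i < j) (jap i)%:R ^+ eta * (`|k i|%:~R : R).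
  by apply: sumr_ge0 => i _; exact: freq_norm_term_ge0.
have := truncnS_gt (freq_norm k).
have : (Num.truncn (freq_norm k)).+1%:R <= j%:R :> R by rewrite ler_nat.
lra.
Qed.

Lemma freq_dotE k (y : nat -> R) J : (forall j, (J <= j)%N -> k j = 0) ->
  freq_dot k y = \sum_(j < J) (k j)%:~R * y j.
Proof.
by move=> kJ; apply: fsbig_nat_ord => j /kJ ->; rewrite mul0r.
Qed.

Lemma freq_dot_le k (y : nat -> R) : Zstar R eta k -> (forall j, 1 <= y j <= 2) ->
  `|freq_dot k y| <= 2 * freq_norm k.
Proof.
move=> kZ y12; rewrite (freq_dotE _ (fun j => @supp_bound_eq0 k j kZ)).
rewrite (le_trans (ler_norm_sum _ _ _))//.
rewrite (le_trans _ (ler_wpM2l _ (sum_le_freq_norm (supp_bound k) kZ)))// mulr_sumr.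
apply: ler_sum => j _; rewrite normrM intr_norm.
have /andP[y1 y2] := y12 j.
have y0 : 0 <= y j by rewrite (le_trans _ y1).
rewrite (ger0_norm y0) mulrC; apply: ler_pM => //.
rewrite ler_peMl// (le_trans _ (jap_le_exp j))// ler1n; exact: jap_gt0.
Qed.

Lemma dioph_prodE k : Zstar R eta k ->
  \big[*%R/1]_(j \in [set: nat]) (1 + `|k j|%:~R `^ eta%:R * (jap j)%:R `^ eta%:R : R)
  = \prod_(j < supp_bound k) (1 + `|k j|%:~R `^ eta%:R * (jap j)%:R `^ eta%:R : R).
Proof.
move=> kZ; apply: fsbig_nat_ord => j /(supp_bound_eq0 kZ) ->.
by rewrite normr0 powR0 ?mul0r ?addr0// pnatr_eq0 -lt0n.
Qed.

(** The choice mu = eta matters here: 1 + a^eta <= (1 + a)^eta <= exp(eta a) with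
a = |k_j| <j>, and <j> <= <j>^eta makes the exponents sum to at most
eta |k|_eta. *)
Lemma dioph_prod_le k : Zstar R eta k ->
  \big[*%R/1]_(j \in [set: nat]) (1 + `|k j|%:~R `^ eta%:R * (jap j)%:R `^ eta%:R : R)
  <= expR (eta%:R * freq_norm k).
Proof.
move=> kZ.
rewrite dioph_prodE//.
rewrite (@le_trans _ _ (\prod_(j < supp_bound k) expR (eta%:R * ((jap j)%:R ^+ eta * (`|k j|%:~R : R)))))//.
  apply: ler_prod => j _; apply/andP; split.
    by rewrite addr_ge0// mulr_ge0// powR_ge0.
  rewrite !powR_mulrn ?ler0z//.
  have a0 : 0 <= `|k j|%:~R * (jap j)%:R :> R by rewrite mulr_ge0 ?ler0z.
  rewrite -exprMn (@le_trans _ _ ((1 + `|k j|%:~R * (jap j)%:R) ^+ eta))//.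
    case: eta eta0 => // n _; elim: n => [|n IH]; first by rewrite !expr1.
    have := exprn_ge0 n.+1 a0; rewrite ![_ ^+ n.+2]exprS; nra.
  rewrite expRM_natl lerXn2r ?nnegrE ?addr_ge0 ?expR_ge0//.
  rewrite (le_trans (expR_ge1Dx _))// ler_expR mulrC ler_wpM2r ?ler0z//.
  exact: jap_le_exp.
rewrite -expR_sum ler_expR -mulr_sumr ler_wpM2l//; exact: sum_le_freq_norm.
Qed.

Lemma dioph_lower gamma rho k (n : int) : 0 < gamma ->
  diophantine eta gamma eta%:R rho -> Zstar R eta k -> k != (fun=> 0) ->
  gamma * expR (- (eta%:R * freq_norm k)) <= `|freq_dot k rho - n%:~R|.
Proof.
move=> g0 D kZ k0; rewrite (le_trans _ (ltW (D k kZ k0 n)))// ler_pM2l// expRN.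
have H := dioph_prod_le kZ.
rewrite lef_pV2 ?posrE ?expR_gt0//.
rewrite dioph_prodE//; apply: prodr_gt0 => j _.
by rewrite ltr_wpDr// mulr_ge0// powR_ge0.
Qed.
End Freq.

(** * Summability over the frequencies *)

Section Counting.
Variables (R : realType) (eta : nat).
Hypothesis eta0 : (0 < eta)%N.
Implicit Types (k : nat -> int).

Definition int_code (z : int) : nat :=
  match z with Posz n => n.*2 | Negz n => n.*2.+1 end.

Lemma int_code_inj : injective int_code.
Proof. by case=> m [] n /= H; [congr Posz|exfalso|exfalso|congr Negz]; lia. Qed.

Lemma int_code_le z : (int_code z <= `|z|.*2)%N.
Proof. by case: z => n //=; lia. Qed.

(** In binary, every entry n contributes one digit 1 and n digits 0 to the code. *)
Lemma code_lt s : (CodeSeq.code s < 2 ^ (\sum_(n <- s) n.+1))%N.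
Proof.
elim: s => [|n s IH]/=; first by rewrite big_nil.
rewrite big_cons expnD expnSr -mulnA.
have : (0 < 2 ^ n)%N by rewrite expn_gt0.
move: IH; set c := CodeSeq.code s; set e := (2 ^ (\sum_(j <- s) _))%N.
set t := (2 ^ n)%N; nia.
Qed.

(** The list has length [supp_bound], so that the length can be read off from the
code, and equal codes force equal frequencies. *)
Definition freq_code k : nat :=
  CodeSeq.code [seq int_code (k j) | j <- iota 0 (supp_bound R eta k)].

Lemma freq_code_inj k l : Zstar R eta k -> Zstar R eta l ->
  freq_code k = freq_code l -> k = l.
Proof.
move=> kZ lZ /(can_inj CodeSeq.codeK) H.
have E : supp_bound R eta k = supp_bound R eta l.
  by have := congr1 size H; rewrite !size_map !size_iota.
apply/funext => j; have [jJ|Jj] := ltnP j (supp_bound R eta k); last first.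
  by rewrite (supp_bound_eq0 eta0 kZ Jj) (supp_bound_eq0 eta0 lZ)// -E.
have := congr1 (fun s => nth 0%N s j) H.
rewrite !(nth_map 0%N) ?size_iota -?E// !nth_iota -?E// add0n.
exact: int_code_inj.
Qed.

Lemma freq_code_le k : Zstar R eta k ->
  ((freq_code k).+1%:R : R) <= expR (3 * freq_norm R eta k + 1).
Proof.
move=> kZ.
rewrite (@le_trans _ _ ((2 ^ (\sum_(j < supp_bound R eta k) (`|k j|.*2).+1))%:R))//.
  rewrite ler_nat (leq_trans (code_lt _))// leq_exp2l// big_map.
  rewrite -(big_mkord xpredT (fun j => (`|k j|.*2).+1)) /index_iota subn0.
  by apply: leq_sum => j _; rewrite ltnS int_code_le.
rewrite natrX.
(* 2 <= e turns powers of 2 into exponentials. *)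
have e2 : (2 : R) <= expR 1 by rewrite (le_trans _ (expR_ge1Dx _)).
rewrite (@le_trans _ _ (expR 1 ^+ (\sum_(j < supp_bound R eta k) (`|k j|.*2).+1)))//.
  by rewrite lerXn2r ?nnegrE ?expR_ge0.
rewrite -expRM_natl mulr1 ler_expR natr_sum.
have := sum_le_freq_norm (supp_bound R eta k) kZ; have := supp_bound_le kZ.
set S := \sum_(_ < _) _ => Jx Sx.
have : \sum_(j < supp_bound R eta k) (`|k j|.*2).+1%:R <= 2 * S + (supp_bound R eta k)%:R :> R.
  rewrite -[X in _ + X%:R]card_ord -sum1_card natr_sum mulr_sumr -big_split/=.
  apply: ler_sum => j _.
  rewrite -natr1 lerD2r -muln2 natrM mulrC ler_wpM2l//.
  rewrite -[leLHS]mul1r -abszE ler_wpM2r// exprn_ege1// ler1n; exact: jap_gt0.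
lra.
Qed.

Lemma sum_invsq_le (s : seq nat) : uniq s ->
  \sum_(n <- s) (n.+1%:R ^- 2) <= 2 :> R.
Proof.
move=> us; pose B := (\max_(n <- s) n).+1.
have E : perm_eq s [seq n <- iota 0 B | n \in s].
  apply: uniq_perm => //; first by rewrite filter_uniq// iota_uniq.
  move=> n; rewrite mem_filter mem_iota/= add0n.
  case: (boolP (n \in s)) => //= ns; rewrite ltnS; apply/esym.
  exact: (@leq_bigmax_seq _ _ xpredT id).
have -> : \sum_(n <- s) n.+1%:R ^- 2 = \sum_(n <- iota 0 B | n \in s) n.+1%:R ^- 2 :> R.
  by rewrite -[RHS]big_filter; exact: perm_big.
rewrite big_mkcond/=.
rewrite (@le_trans _ _ (\sum_(n <- iota 0 B) (n.+1%:R ^- 2)))//.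
  by apply: ler_sum => n _; case: ifP => // _; rewrite invr_ge0 exprn_ge0.
rewrite (_ : iota 0 B = index_iota 0 B) ?big_mkord; last by rewrite /index_iota subn0.
have H N : \sum_(n < N.+1) (n.+1%:R ^- 2) <= 2 - (N.+1%:R)^-1 :> R.
  elim: N => [|N IH]; first by rewrite big_ord_recr big_ord0/= expr1n invr1; lra.
  rewrite big_ord_recr/= (le_trans (lerD IH (lexx _)))//.
  have N0 : 0 < N.+1%:R :> R by [].
  rewrite -[N.+2%:R]natr1; set x := N.+1%:R in N0 *.
  rewrite -subr_ge0 (_ : _ - _ = (x * (x + 1) ^+ 2)^-1); last by field; apply/andP; split; lra.
  by rewrite invr_ge0 mulr_ge0 ?exprn_ge0//; lra.
by rewrite (le_trans (H _))// gerBl.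
Qed.

(** The code c of k satisfies c + 1 <= exp(3 |k| + 1), hence
exp(-exp(|k|)/2) <= 64 * 720 * e^2 / (c + 1)^2 by the series of exp at order 6,
and the codes are distinct. *)
Lemma Zstar_sum_le (A : {fset (Zstar R eta)}) :
  \sum_(k : A) expR (- (2^-1 * expR (freq_norm R eta (val (val k))))) <= 2 * (64 * 720 * expR 2).
Proof.
set c := 64 * _ * _.
pose F (k : A) := freq_code (val (val k)).
have kZ (k : A) : Zstar R eta (val (val k)) by exact: set_valP.
have Finj : injective F.
  by move=> k l /(freq_code_inj (kZ _) (kZ _))/val_inj/val_inj.
rewrite (@le_trans _ _ (\sum_(k : A) (F k).+1%:R ^- 2 * c))//; last first.
  rewrite -mulr_suml ler_wpM2r//; first by rewrite /c; have := expR_gt0 (2:R); nra.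
  rewrite -(big_map F xpredT (fun n => n.+1%:R ^- 2)) sum_invsq_le// map_inj_uniq//.
  exact: index_enum_uniq.
apply: ler_sum => k _.
have k0 := freq_code_le (kZ k).
rewrite [leRHS]mulrC ler_pdivlMr ?exprn_gt0//.
set x := freq_norm _ _ _ in k0 *.
have x0 : 0 <= x by exact: freq_norm_ge0.
rewrite (le_trans (ler_wpM2l (expR_ge0 _) (_ : _ <= expR (3 * x + 1) ^+ 2)))//.
  by rewrite lerXn2r ?nnegrE ?expR_ge0.
have := @exprM_expRN_le R 6 (2^-1 * expR x); rewrite mulr_ge0 ?expR_ge0// => /(_ isT).
rewrite -expRM_natl (_ : 2%:R * (3 * x + 1) = 6%:R * x + 2); last by ring.
rewrite expRD [expR (6%:R * x)]expRM_natl exprMn /c.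
set e2 := expR 2; set ee := expR (- _); set y := expR x ^+ 6.
have e0 : 0 <= e2 := expR_ge0 _.
rewrite (_ : 6`! = 720%N)// => h.
have h2 : ee * y <= 64 * 720.
  have -> : ee * y = 64 * (2^-1 ^+ 6 * y * ee) by field.
  by rewrite ler_wpM2l.
by rewrite mulrA ler_wpM2r.
Qed.
End Counting.

(** * The real-valued norm of a complex Banach space *)

Section Norm.
Context {R : realType} {B : completeNormedModType R[i]}.
Implicit Types (u v : B).

Lemma bnormE v : `|v| = (bnorm v)%:C.
Proof. exact/ge0_ReE/normr_ge0. Qed.

Lemma bnorm_ge0 v : 0 <= bnorm v.
Proof. by rewrite -ler0c -bnormE. Qed.

Lemma bnorm_le v (r : R) : (bnorm v <= r) = (`|v| <= r%:C).
Proof. by rewrite bnormE lecR. Qed.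

Lemma bnormD u v : bnorm (u + v) <= bnorm u + bnorm v.
Proof. by rewrite -lecR rmorphD/= -!bnormE ler_normD. Qed.

Lemma bnormB u v : bnorm (u - v) = bnorm (v - u).
Proof. by rewrite /bnorm distrC. Qed.

Lemma bnorm_dist_le u v w : bnorm (u - w) <= bnorm (u - v) + bnorm (v - w).
Proof. by rewrite (le_trans _ (bnormD _ _))// addrA subrK. Qed.

Lemma norm_real_complex (r : R) : `|r%:C| = `|r|%:C.
Proof. by rewrite normc_def/= expr0n addr0 sqrtr_sqr. Qed.

Lemma bnormZ (r : R) v : bnorm (r%:C *: v) = `|r| * bnorm v.
Proof.
by apply: complexI; rewrite -bnormE normrZ norm_real_complex bnormE -rmorphM.
Qed.

Lemma bnorm_sum I (s : seq I) (P : pred I) (F : I -> B) :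
  bnorm (\sum_(i <- s | P i) F i) <= \sum_(i <- s | P i) bnorm (F i).
Proof.
rewrite bnorm_le (le_trans (ler_norm_sum _ _ _))// rmorph_sum/=.
by apply: ler_sum => i _; rewrite bnormE.
Qed.

Lemma cvg_bnormP {T : Type} (F : set_system T) {FF : Filter F} (f : T -> B) (l : B) :
  f @ F --> l <-> forall e : R, 0 < e -> \forall t \near F, bnorm (l - f t) <= e.
Proof.
split=> [/cvgrPdist_le H e e0|H].
  have /H : 0 < e%:C by rewrite ltcR.
  by apply: filterS => t; rewrite bnorm_le.
apply/cvgrPdist_le => e e0.
have eE : e = (complex.Re e)%:C by apply/ge0_ReE/ltW.
have /H : 0 < complex.Re e by rewrite -ltcR -eE.
by apply: filterS => t; rewrite bnorm_le -eE.
Qed.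

(** A norm bound valid along a filter passes to the limit; this is the only way in
which Fourier series are summed below. *)
Lemma cvg_bnorm_le {T : Type} (F : set_system T) {FF : ProperFilter F} (f : T -> B) (l : B) (r : R) :
  f @ F --> l -> (\forall t \near F, bnorm (f t) <= r) -> bnorm l <= r.
Proof.
move=> /cvg_bnormP fl fr; apply/ler_addgt0Pr => e e0.
have [t [tl tr]] := @filter_ex _ F _ _ (filterI (fl e e0) fr).
rewrite addrC -[l](subrK (f t)) (le_trans (bnormD _ _))//; exact: lerD.
Qed.
End Norm.

(** * Integrals of functions constant on a finite partition *)

(** The type [X] is arbitrary so that the same sets serve under every measurable
structure. *)
Definition cell (X : Type) (D : set X) (K : finType) (p : X -> K) (i : K) : set X :=
  D `&` p @^-1` [set i].

Section PartitionIntegral.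
Context {R : realType} {B : completeNormedModType R[i]}.
Context {d : measure_display} {X : measurableType d}.
Variables (mu : {measure set X -> \bar R}) (D : set X).
Hypotheses (mD : measurable D) (muD : (mu D < +oo)%E).

(** Monotonicity without measurability: a nonnegative integral is a supremum over
the simple functions below the integrand. The integrands met here involve
arbitrary approximations, whose measurability is not known. *)
Lemma nonneg_le_integral (f1 f2 : X -> \bar R) :
  (forall x, D x -> 0 <= f1 x)%E -> (forall x, D x -> f1 x <= f2 x)%E ->
  (\int[mu]_(x in D) f1 x <= \int[mu]_(x in D) f2 x)%E.
Proof.
move=> f10 f12.
have f20 x : D x -> (0 <= f2 x)%E by move=> Dx; rewrite (le_trans (f10 x Dx))// f12.
rewrite (ge0_integralE _ f10) (ge0_integralE _ f20).
apply: ereal_sup_le => _ [h hf <-]; exists h => // x; rewrite (le_trans (hf x))//.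
rewrite /patch; case: ifPn => // /set_mem; exact: f12.
Qed.

Definition cell_mass (K : finType) (p : X -> K) (i : K) : R := fine (mu (cell D p i)).

Lemma cell_fin (K : finType) (p : X -> K) i :
  measurable (cell D p i) -> mu (cell D p i) = (cell_mass p i)%:E.
Proof.
move=> mc; rewrite fineK// ge0_fin_numE// (le_lt_trans _ muD)//.
by apply: le_measure => [||x []//]; apply/mem_set.
Qed.

Lemma cell_mass_ge0 (K : finType) (p : X -> K) i : 0 <= cell_mass p i.
Proof. exact: fine_ge0. Qed.

Lemma preimage_cells (K : finType) (p : X -> K) (Q : pred K) :
  D `&` [set x | Q (p x)] = \bigcup_(i in [set i | Q i]) cell D p i.
Proof.
apply/seteqP; split=> [x [Dx Qx]|x [i Qi [Dx /= pxi]]]; first by exists (p x).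
by split=> //=; rewrite pxi.
Qed.

Lemma measure_preimage_cells (K : finType) (p : X -> K) (Q : pred K) :
  (forall i, measurable (cell D p i)) ->
  mu (D `&` [set x | Q (p x)]) = (\sum_(i | Q i) cell_mass p i)%:E.
Proof.
move=> mp; rewrite preimage_cells measure_fin_bigcup//.
- rewrite -sumEFin (fsbigE (enum [set i | Q i]%SET)).
  + rewrite big_enum_cond/=; apply: eq_big => [i|i _]; last exact: cell_fin.
    by rewrite finset.inE; apply/andb_idr => Qi; rewrite classical_sets.inE.
  + exact: enum_uniq.
  + by move=> i /=; rewrite mem_enum finset.inE.
  + by move=> i Qi; rewrite mem_enum finset.inE Qi.
- exact: finite_finset.
- apply/trivIsetP => i j _ _ /negP ij; rewrite -subset0 => x [[_ /= pi] [_ /= pj]].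
  by apply: ij; rewrite -pi -pj.
Qed.

Lemma measurable_preimage_cells (K : finType) (p : X -> K) (Q : pred K) :
  (forall i, measurable (cell D p i)) -> measurable (D `&` [set x | Q (p x)]).
Proof.
by move=> mp; rewrite preimage_cells; apply: fin_bigcup_measurable => //.
Qed.

Lemma preimage_comp_pred (K : finType) (p : X -> K) (g : K -> B) b :
  D `&` (g \o p) @^-1` [set b] = D `&` [set x | g (p x) == b].
Proof. by congr (_ `&` _); apply/seteqP; split=> x /= /eqP. Qed.

Lemma partition_simple (K : finType) (p : X -> K) (g : K -> B) :
  (forall i, measurable (cell D p i)) -> simple_integrable mu D (g \o p).
Proof.
move=> mp; split.
- apply: (@sub_finite_set _ _ (g @` setT)); first by move=> _ [x _ <-]; exists (p x).
  exact/finite_image/finite_finset.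
- by move=> b; rewrite preimage_comp_pred; exact: (@measurable_preimage_cells _ p (fun i => g i == b)).
- move=> b _; rewrite preimage_comp_pred (@measure_preimage_cells _ p (fun i => g i == b))//.
  exact: ltry.
Qed.

(** The values [g i] need not be distinct, whereas the integral of a simple function
is a sum over distinct nonzero values: equal values are grouped, and values taken
nowhere have an empty cell. *)
Lemma partition_simple_integral (K : finType) (p : X -> K) (g : K -> B) :
  (forall i, measurable (cell D p i)) ->
  simple_integral mu D (g \o p) = \sum_i (cell_mass p i)%:C *: g i.
Proof.
move=> mp; have [fr _ _] := partition_simple g mp.
have fr0 : finite_set (range (g \o p) `\ 0) by apply: sub_finite_set fr; exact: subIsetl.
rewrite /simple_integral (fsbigE (fset_set (range (g \o p) `\ 0)))/=; last first.
- by move=> b bS; rewrite in_fset_set// notin_setE => /(_ bS).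
- by move=> b; rewrite /= in_fset_set// => /set_mem.
- exact: fset_uniq.
set S := fset_set _.
transitivity (\sum_(b <- S) \sum_(i | g i == b) (cell_mass p i)%:C *: g i).
  rewrite [LHS]big_seq_cond [RHS]big_seq; apply: eq_big => [b|b /andP[bS _]].
    by rewrite in_fset_set//; case: (_ \in _).
  rewrite preimage_comp_pred (@measure_preimage_cells _ p (fun i => g i == b))//=.
  by rewrite rmorph_sum/= scaler_suml; apply: eq_bigr => i /eqP ->.
rewrite (eq_bigr (fun b => \sum_i if g i == b then (cell_mass p i)%:C *: g i else 0)); last first.
  by move=> b _; rewrite big_mkcond.
rewrite exchange_big/=; apply: eq_bigr => i _.
have [iS|iS] := boolP (g i \in S).
  rewrite (big_rem (g i))//= eqxx big1_seq ?addr0// => b /andP[_].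
  rewrite rem_filter ?fset_uniq// mem_filter/= => /andP[+ _].
  by rewrite eq_sym => /negbTE ->.
rewrite big1_seq; last first.
  by move=> b /andP[_ bS]; case: eqP => // gib; move: iS; rewrite gib bS.
move: iS; rewrite in_fset_set// notin_setE => /not_andP[gi|/contrapT ->]; last by rewrite scaler0.
rewrite /cell_mass (_ : cell D p i = set0) ?measure0 ?scale0r//.
rewrite -subset0 => x [_ /= pxi]; apply: gi; exists x => //=; by rewrite pxi.
Qed.

End PartitionIntegral.

(** * Comparison of simple functions *)

Section Compare.
Context {R : realType} {B : completeNormedModType R[i]}.
Context {d : measure_display} {X : measurableType d}.
Variables (mu : {measure set X -> \bar R}) (D : set X).
Hypotheses (mD : measurable D) (muD : (mu D < +oo)%E).

Lemma simple_partition (s : X -> B) : simple_integrable mu D s ->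
  exists (K : finType) (p : X -> K) (g : K -> B),
    s = g \o p /\ forall i, measurable (cell D p i).
Proof.
move=> [fs ms _]; pose K : finType := fset_set (range s).
have inK x : s x \in fset_set (range s) by rewrite in_fset_set//; apply/mem_set; exists x.
exists K, (fun x => FSetSub (inK x)), val; split=> // i.
rewrite (_ : cell _ _ _ = D `&` s @^-1` [set val i]); first exact: ms.
rewrite /cell; congr (_ `&` _); apply/seteqP; split=> x /=; first by move=> <-.
by move=> sxi; apply: val_inj.
Qed.

Lemma cell_pair (K1 K2 : finType) (p1 : X -> K1) (p2 : X -> K2) :
  (forall i, measurable (cell D p1 i)) -> (forall i, measurable (cell D p2 i)) ->
  forall i, measurable (cell D (fun x => (p1 x, p2 x)) i).
Proof.
move=> m1 m2 [i j].
rewrite (_ : cell _ _ _ = cell D p1 i `&` cell D p2 j); first exact: measurableI.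
apply/seteqP; split=> [x [Dx /= [<- <-]]//|x [[Dx /= <-] [_ /= <-]]//].
Qed.

(** On each cell the distance of the two values minus e is a lower bound for the
distance of F to the first value; integrating the resulting measurable step
function bounds the integral of a possibly non-measurable function from below. *)
Lemma partition_integral_cmp (K : finType) (p : X -> K) (g1 g2 : K -> B) (F : X -> B) (e : R) :
  (forall i, measurable (cell D p i)) ->
  (forall x, D x -> bnorm (F x - g2 (p x)) <= e) ->
  ((bnorm (simple_integral mu D (g1 \o p) - simple_integral mu D (g2 \o p)))%:E <=
   \int[mu]_(x in D) (bnorm (F x - g1 (p x)))%:E + (e * fine (mu D))%:E)%E.
Proof.
move=> mp Fg2; rewrite !partition_simple_integral//.
(* The largest lower bound for |F - g1| that the cell provides. *)
pose c i := Num.max 0 (bnorm (g1 i - g2 i) - e).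
have c0 i : 0 <= c i by rewrite le_max lexx.
pose m i := cell_mass mu D p i.
have mD1 : fine (mu D) = \sum_i m i.
  have := measure_preimage_cells mD muD (fun=> true) mp.
  rewrite (_ : D `&` _ = D); first by move=> ->.
  by apply/seteqP; split=> x // [].
have lec : bnorm (\sum_i (m i)%:C *: g1 i - \sum_i (m i)%:C *: g2 i) <=
    \sum_i m i * c i + e * fine (mu D).
  rewrite mD1 -sumrB mulr_sumr -big_split/= (le_trans (bnorm_sum _ _ _))//.
  apply: ler_sum => i _; rewrite -scalerBr bnormZ ger0_norm ?cell_mass_ge0//.
  rewrite [e * _]mulrC -mulrDr ler_wpM2l ?cell_mass_ge0//.
  by rewrite -lerBlDr le_max lexx orbT.
apply: (@le_trans _ _ ((\sum_i m i * c i)%:E + (e * fine (mu D))%:E)%E).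
  by rewrite -EFinD lee_fin.
apply: leeD => //.
rewrite (_ : (\sum_i m i * c i)%R%:E = \int[mu]_(x in D) (\sum_i (c i * \1_(cell D p i) x)%R%:E))%E; last first.
  rewrite ge0_integral_sum//.
  - rewrite -sumEFin; apply: eq_bigr => i _.
    under eq_integral do rewrite EFinM.
    rewrite ge0_integralZl_EFin//.
    + rewrite integral_indic// (_ : cell D p i `&` D = cell D p i).
        by rewrite cell_fin// -EFinM mulrC.
      by apply/seteqP; split=> [x []|x [Dx px]].
    + by apply/measurable_EFinP; exact: measurable_indic.
  - move=> i; apply/measurable_EFinP; apply: measurable_funM => //.
  - by move=> i x _; rewrite lee_fin mulr_ge0.
apply: nonneg_le_integral => x Dx.
  by apply: sume_ge0 => i _; rewrite lee_fin mulr_ge0.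
rewrite sumEFin lee_fin (bigD1 (p x))//= big1 ?addr0; last first.
  move=> i ip; rewrite indicE memNset ?mulr0// => -[_ /= pxi].
  by rewrite pxi eqxx in ip.
rewrite indicE mem_set// mulr1 /c ge_max bnorm_ge0/= lerBlDr.
by rewrite (le_trans (bnorm_dist_le _ (F x) _))// bnormB lerD2l Fg2.
Qed.

End Compare.

(** * Riemann sums of Lipschitz functions *)

Section Riemann.
Context {R : realType} {B : completeNormedModType R[i]}.
Variables (F : R -> B) (T L : R).
Hypotheses (T0 : 0 < T) (L0 : 0 <= L).
Hypothesis FL : forall s t, 0 <= s <= T -> 0 <= t <= T -> bnorm (F s - F t) <= L * `|s - t|.

Let D : set R := `[0, T]%classic.

(** The extra index N is reached only at the right endpoint, a null set; in this way
all cells are half-open. *)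
Definition grid_index N (t : R) : 'I_N.+1 := inord (Num.truncn (t * N%:R / T)).
Definition grid_value N (i : 'I_N.+1) : B := F (i%:R * (T / N%:R)).
Definition riemann_sum N : B := (T / N%:R)%:C *: \sum_(i < N) F (i%:R * (T / N%:R)).

Let mD : measurable D. Proof. exact: measurable_itv. Qed.

Lemma lebesgue_itv_fin : (lebesgue_measure D < +oo)%E.
Proof. by rewrite /D lebesgue_measure_itv/= lte_fin T0 ltry. Qed.
Let muD := lebesgue_itv_fin.

Lemma lebesgue_itv_mass : fine (lebesgue_measure D) = T.
Proof. by rewrite /D lebesgue_measure_itv/= lte_fin T0 /= oppr0 addr0. Qed.

Lemma grid_indexP N t : (0 < N)%N -> D t ->
  (grid_index N t)%:R * (T / N%:R) <= t < (grid_index N t)%:R * (T / N%:R) + T / N%:R.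
Proof.
move=> N0; rewrite /D/= in_itv/= => /andP[t0 tT].
have N0' : 0 < N%:R :> R by rewrite ltr0n.
have h0 : 0 < T / N%:R by rewrite divr_gt0.
have tE : t * N%:R / T = t / (T / N%:R) by field; rewrite !gt_eqF.
rewrite /grid_index tE inordK; last first.
  rewrite ltnS truncn_le_nat ltr_pdivrMr// -natr1 mulrDl mul1r.
  have -> : N%:R * (T / N%:R) = T by field; rewrite gt_eqF.
  by rewrite (le_lt_trans tT)// ltrDl.
have /truncn_itv/andP[] : 0 <= t / (T / N%:R) by rewrite divr_ge0// ltW.
rewrite ler_pdivlMr// ltr_pdivrMr// => -> /=.
by rewrite -natr1 mulrDl mul1r.
Qed.

Lemma grid_succ (j : nat) (h : R) : j%:R * h + h = j.+1%:R * h.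
Proof. by rewrite -natr1 mulrDl mul1r. Qed.

Lemma grid_cellE N (i : 'I_N.+1) : (0 < N)%N ->
  cell D (grid_index N) i =
  D `&` `[i%:R * (T / N%:R), i%:R * (T / N%:R) + T / N%:R[%classic.
Proof.
move=> N0; apply/seteqP; split=> [t [Dt /= <-]|t [Dt]].
  by split=> //=; rewrite in_itv/=; exact: grid_indexP.
rewrite /= in_itv/= => /andP[t1 t2]; split=> //=.
have /andP[t3 t4] := grid_indexP N0 Dt.
have h0 : 0 < T / N%:R by rewrite divr_gt0// ltr0n.
apply/val_inj/eqP => /=; rewrite eqn_leq; apply/andP; split.
- have := le_lt_trans t3 t2; rewrite grid_succ ltr_pM2r// ltr_nat.
  by rewrite ltnS.
- have := le_lt_trans t1 t4; rewrite grid_succ ltr_pM2r// ltr_nat.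
  by rewrite ltnS.
Qed.

Lemma measurable_grid_cell N (i : 'I_N.+1) : (0 < N)%N ->
  measurable (cell D (grid_index N) i).
Proof. by move=> N0; rewrite grid_cellE//; apply: measurableI => //; exact: measurable_itv. Qed.

Lemma grid_mass N (i : 'I_N.+1) : (0 < N)%N ->
  cell_mass lebesgue_measure D (grid_index N) i = if (i < N)%N then T / N%:R else 0.
Proof.
move=> N0; rewrite /cell_mass grid_cellE//.
have N0' : 0 < N%:R :> R by rewrite ltr0n.
have h0 : 0 < T / N%:R by rewrite divr_gt0.
have TE : T = N%:R * (T / N%:R) by field; rewrite gt_eqF.
case: ltnP => iN.
  rewrite (_ : _ `&` _ = `[i%:R * (T / N%:R), i%:R * (T / N%:R) + T / N%:R[%classic).
    apply: (etrans (congr1 fine (lebesgue_measure_itv _))).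
    rewrite /= lte_fin ltrDl h0 /=; ring.
  apply/seteqP; split=> [t []//|t/= ti]; split=> //; move: ti; rewrite /D/= !in_itv/=.
  move=> /andP[t1 t2]; apply/andP; split.
    by rewrite (le_trans _ t1)// mulr_ge0// ltW.
  by rewrite (le_trans (ltW t2))// [leRHS]TE grid_succ (ler_wpM2r (ltW h0))// ler_nat.
have iNE : nat_of_ord i = N by apply/eqP; rewrite eqn_leq iN -ltnS ltn_ord.
rewrite (_ : _ `&` _ = [set T]); first exact: (congr1 fine (lebesgue_measure_set1 T)).
rewrite iNE -TE; apply/seteqP; split=> [t []|t/= ->]; rewrite /D/= !in_itv/=.
  move=> /andP[t0 tT] /andP[t1 t2]; apply/eqP; by rewrite eq_le tT t1.
by rewrite lexx ltW//= ltrDl.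
Qed.

Lemma simple_integral_grid N : (0 < N)%N ->
  simple_integral lebesgue_measure D (@grid_value N \o grid_index N) = riemann_sum N.
Proof.
move=> N0; rewrite partition_simple_integral//; last by move=> i; exact: measurable_grid_cell.
rewrite big_ord_recr/= grid_mass// ltnn scale0r addr0 /riemann_sum scaler_sumr.
apply: eq_bigr => i _; rewrite grid_mass//= ltn_ord//.
Qed.

Lemma grid_value_close N t : (0 < N)%N -> D t ->
  bnorm (F t - grid_value (grid_index N t)) <= L * (T / N%:R).
Proof.
move=> N0 Dt; have /andP[t1 t2] := grid_indexP N0 Dt.
have h0 : 0 < T / N%:R by rewrite divr_gt0// ltr0n.
move: (Dt); rewrite /D/= in_itv/= => /andP[t3 t4].
apply: (le_trans (FL _ _)); first by rewrite t3.
  by rewrite mulr_ge0 ?(ltW h0)//= (le_trans t1).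
by rewrite ler_wpM2l// ger0_norm ?subr_ge0// lerBlDl ltW.
Qed.

Lemma inv_succ_small (c e : R) : 0 < e -> \forall n \near \oo, c / n.+1%:R <= e.
Proof.
move=> e0; near=> n; rewrite ler_pdivrMr// mulrC -ler_pdivrMr//.
rewrite (le_trans (ltW (truncnS_gt (c / e))))// ler_nat ltnS.
near: n; exact: nbhs_infty_ge.
Unshelve. all: by end_near. Qed.

Lemma grid_approx :
  bochner_approx lebesgue_measure D F (fun n => @grid_value n.+1 \o grid_index n.+1).
Proof.
split.
- by move=> n; apply: partition_simple => // i; exact: measurable_grid_cell.
- apply: aeW => t Dt; apply/cvg_bnormP => e e0.
  apply: filterS (inv_succ_small (L * T) e0) => n; apply: le_trans.
  by rewrite (le_trans (grid_value_close _ Dt))// mulrA.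
- apply: (@squeeze_cvge _ _ _ _ (cst 0%E) _ (fun n => (L * (T / n.+1%:R) * T)%:E)).
  + near=> n; apply/andP; split.
      by apply: integral_ge0 => t _; rewrite lee_fin bnorm_ge0.
    rewrite (_ : (_ * T)%:E = \int[lebesgue_measure]_(x in D) (cst (L * (T / n.+1%:R))%:E x))%E.
      apply: nonneg_le_integral => // t Dt; rewrite lee_fin ?bnorm_ge0//.
      exact: grid_value_close.
    rewrite integral_cst//; first by rewrite -[X in _ = (_ * X)%E]fineK ?lebesgue_itv_mass// ge0_fin_numE.
  + exact: cvg_cst.
  + apply: cvg_EFin; first by near=> n.
    apply/cvgrPdist_le => e e0; rewrite /comp/=.
    apply: filterS (inv_succ_small (L * T * T) e0) => n; apply: le_trans.
    rewrite sub0r normrN ger0_norm; last by rewrite !mulr_ge0 ?(ltW T0)// invr_ge0.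
    by rewrite !mulrA mulrAC.
Unshelve. all: by end_near. Qed.

(** Any simple function and the step function of the grid are constant on a common
finite partition. *)
Lemma riemann_sum_cmp (s : R -> B) N : (0 < N)%N -> simple_integrable lebesgue_measure D s ->
  ((bnorm (simple_integral lebesgue_measure D s - riemann_sum N))%:E <=
   \int[lebesgue_measure]_(x in D) (bnorm (F x - s x))%:E + (L * (T / N%:R) * T)%:E)%E.
Proof.
move=> N0 /simple_partition[K [p [g [-> mp]]]].
rewrite -simple_integral_grid//.
pose q x := (p x, grid_index N x).
have -> : g \o p = (g \o fst) \o q by [].
have -> : @grid_value N \o grid_index N = (@grid_value N \o snd) \o q by [].
rewrite -[X in (L * _ * X)%:E]lebesgue_itv_mass.
apply: (@partition_integral_cmp _ _ _ _ lebesgue_measure D mD muD _ q (g \o fst) (@grid_value N \o snd)).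
- by apply: cell_pair => // i; exact: measurable_grid_cell.
- by move=> t Dt; exact: grid_value_close.
Qed.

(** Whatever approximating sequence defines the integral, it is pinned down by the
Riemann sums; hence the integral is unique. *)
Lemma bochner_riemann (s : nat -> R -> B) (I : B) :
  bochner_approx lebesgue_measure D F s ->
  (fun n => simple_integral lebesgue_measure D (s n)) @ \oo --> I ->
  forall N, (0 < N)%N -> bnorm (I - riemann_sum N) <= L * (T / N%:R) * T.
Proof.
move=> [ss _ s0] sI N N0; apply/ler_addgt0Pr => e e0.
have e2 : 0 < e / 2 by rewrite divr_gt0.
move/cvg_bnormP : sI => /(_ _ e2) h1.
have h2 : \forall n \near \oo, (\int[lebesgue_measure]_(x in D) (bnorm (F x - s n x))%:E <= (e / 2)%:E)%E.
  move/fine_cvgP : s0 => [s01 /cvgrPdist_le/(_ _ e2) s02].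
  near=> n.
  have fn : (\int[lebesgue_measure]_(x in D) (bnorm (F x - s n x))%:E)%E \is a fin_num.
    by near: n.
  rewrite -(fineK fn) lee_fin.
  have : `|0 - fine (\int[lebesgue_measure]_(x in D) (bnorm (F x - s n x))%:E)%E| <= e / 2.
    by near: n.
  by rewrite sub0r normrN; apply: le_trans; exact: ler_norm.
have [n [n1 n2]] := filter_ex (filterI h1 h2).
have := riemann_sum_cmp N0 (ss n).
move=> /le_trans/(_ (leeD n2 (lexx _))); rewrite -EFinD lee_fin => h3.
rewrite (le_trans (bnorm_dist_le _ (simple_integral lebesgue_measure D (s n)) _))//.
lra.
Unshelve. all: by end_near. Qed.

Lemma riemann_sum_cvg_of (I : B) :
  (forall N, (0 < N)%N -> bnorm (I - riemann_sum N) <= L * (T / N%:R) * T) ->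
  (fun n => riemann_sum n.+1) @ \oo --> I.
Proof.
move=> H; apply/cvg_bnormP => e e0.
apply: filterS (inv_succ_small (L * T * T) e0) => n; apply: le_trans.
by rewrite (le_trans (H _ _))// !mulrA mulrAC.
Qed.

Lemma riemann_sum_dist M N : (0 < M)%N -> (0 < N)%N ->
  bnorm (riemann_sum M - riemann_sum N) <= L * (T / M%:R) * T + L * (T / N%:R) * T.
Proof.
move=> M0 N0; rewrite -(simple_integral_grid M0).
have sg : simple_integrable lebesgue_measure D (@grid_value M \o grid_index M).
  by apply: partition_simple => // i; exact: measurable_grid_cell.
have mg := riemann_sum_cmp N0 sg.
rewrite -lee_fin EFinD; apply: (le_trans mg); apply: leeD => //.
apply: (@le_trans _ _ (\int[lebesgue_measure]_(x in D) (cst (L * (T / M%:R))%:E x))%E).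
  apply: nonneg_le_integral => // t Dt; rewrite lee_fin ?bnorm_ge0//.
  exact: grid_value_close.
rewrite integral_cst//.
have mDT : lebesgue_measure D = T%:E by rewrite -lebesgue_itv_mass fineK// ge0_fin_numE.
by rewrite [leLHS](congr1 (mule _) mDT).
Qed.

Lemma riemann_sum_is_cvg : cvg ((fun n => riemann_sum n.+1) @ \oo).
Proof.
apply/cauchy_cvgP/cauchy_exP => e e0.
have eE : e = (complex.Re e)%:C by apply/ge0_ReE/ltW.
set r := complex.Re e in eE; have r0 : 0 < r by rewrite -ltcR -eE.
have r3 : 0 < r / 3 by rewrite divr_gt0.
have H := inv_succ_small (L * T * T) r3.
have [m Hm] := filter_ex H.
exists (riemann_sum m.+1); apply: filterS H => n Hn.
rewrite /= -ball_normE/= eE bnormE ltcR.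
apply: (le_lt_trans (riemann_sum_dist _ _)) => //.
have E k : L * (T / k.+1%:R) * T = L * T * T / k.+1%:R by rewrite !mulrA mulrAC.
rewrite !E (le_lt_trans (lerD Hm Hn))//.
by rewrite -mulrDl ltr_pdivrMr// -mulr2n -[r *+ 2]mulr_natr ltr_pM2l// ltr_nat.
Qed.

(** Existence follows from completeness, since the Riemann sums form a Cauchy
sequence, and the chosen value of the integral is identified by
[bochner_riemann]. *)
Lemma bochner_integral_lipschitz :
  bochner_integrable lebesgue_measure D F /\
  (fun n => riemann_sum n.+1) @ \oo --> bochner_integral lebesgue_measure D F.
Proof.
split; first by eexists; exact: grid_approx.
have HI : is_bochner_integral lebesgue_measure D F (bochner_integral lebesgue_measure D F).
  rewrite /bochner_integral; apply: (xgetPex 0).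
  exists (lim ((fun n => riemann_sum n.+1) @ \oo)); eexists; first exact: grid_approx.
  rewrite (_ : (fun n => _) = (fun n => riemann_sum n.+1)); first exact: riemann_sum_is_cvg.
  by apply/funext => n; rewrite simple_integral_grid.
have [s sa sI] := HI.
by apply: riemann_sum_cvg_of; exact: bochner_riemann sa sI.
Qed.
End Riemann.

(** * The mass of the weight *)

Section BumpIntegral.
Variable R : realType.
Implicit Types (a b c x y : R).
Local Notation w := (@wbump R).
Local Notation leb := (@lebesgue_measure R).

Lemma wbump_lipschitz x y : `|w x - w y| <= 8 *  `|x - y| .
Proof.
wlog xy : x y / y <= x => [H|].
  by have [/H//|/ltW/H] := leP y x; rewrite distrC (distrC y).
have h0 : 0 <= x - y by rewrite subr_ge0.
have := iter_bdiff_flat_pair_le 1 0 0 x h0.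
rewrite (_ : (0 + 0 + 1.*2)`! = 2)//.
rewrite /= /bdiff subKr expr1 (ger0_norm h0); rewrite /wbump; lra.
Qed.

Lemma wbump_continuous : continuous w.
Proof.
move=> x; apply: differentiable_continuous; apply/derivable1_diffP.
by have [] := is_derive_flat_pair 0 0 x.
Qed.

Lemma wbump_raw x : 0 < x < 1 -> w x = wbar_raw x.
Proof.
move=> /andP[x0 x1]; rewrite /wbump /flat_pair /flat x0 subr_gt0 x1 !expr0 !mul1r -expRD /wbar_raw.
congr expR; field; apply/andP; split; last by rewrite gt_eqF.
by rewrite subr_eq0 gt_eqF.
Qed.

Lemma wbump_integrable a b (l r : bool) :
  leb.-integrable [set` Interval (BSide l a) (BSide r b)] (EFin \o w).
Proof.
have H : leb.-integrable `[a, b]%classic (EFin \o w).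
  apply: continuous_compact_integrable; first exact: segment_compact.
  exact/continuous_subspaceT/wbump_continuous.
apply: (integrableS _ _ _ H) => //.
by apply: subset_itv; rewrite bnd_simp; case: l; case: r; rewrite ?lexx.
Qed.

Lemma Rintegral_cst_oc a b c : a <= b -> \int[leb]_(x in `]a, b]) c = c * (b - a).
Proof.
move=> ab; rewrite Rintegral_cst//; congr (_ * _).
apply: (etrans (congr1 fine (lebesgue_measure_itv _))).
rewrite /= lte_fin; case: ltgtP ab => //= -> _; by rewrite subrr.
Qed.

Lemma cst_integrable_oc a b c : leb.-integrable `]a, b]%classic (EFin \o cst c).
Proof.
have H : leb.-integrable `[a, b]%classic (EFin \o cst c).
  apply: continuous_compact_integrable; first exact: segment_compact.
  by apply: continuous_subspaceT => x; exact: cvg_cst.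
by apply: (integrableS _ _ _ H) => //; exact: subset_itv_oc_cc.
Qed.

Definition wbump_int x : R := \int[leb]_(t in `[0, x]) w t.

Lemma wbump_intB a b : 0 <= a -> a <= b ->
  wbump_int b - wbump_int a = \int[leb]_(t in `]a, b]) w t.
Proof.
move=> a0 ab; apply: Rintegral_itvB; rewrite ?bnd_simp//.
exact: wbump_integrable.
Qed.

(** Bounds of the weight on an interval bound the increment of its primitive; applied
on each cell of a grid they compare the integral with a Riemann sum. *)
Lemma wbump_int_ge a b c : 0 <= a -> a <= b ->
  (forall x, a <= x <= b -> c <= w x) -> c * (b - a) <= wbump_int b - wbump_int a.
Proof.
move=> a0 ab cw; rewrite wbump_intB// -(Rintegral_cst_oc _ ab).
apply: le_Rintegral => //; [exact: cst_integrable_oc|exact: wbump_integrable|].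
by move=> x /=; rewrite in_itv/= => /andP[ax xb]; rewrite cw// xb ltW.
Qed.

Lemma wbump_int_le a b c : 0 <= a -> a <= b ->
  (forall x, a <= x <= b -> w x <= c) -> wbump_int b - wbump_int a <= c * (b - a).
Proof.
move=> a0 ab cw; rewrite wbump_intB// -(Rintegral_cst_oc _ ab).
apply: le_Rintegral => //; [exact: wbump_integrable|exact: cst_integrable_oc|].
by move=> x /=; rewrite in_itv/= => /andP[ax xb]; rewrite cw// xb ltW.
Qed.

Lemma wbump_int0 : wbump_int 0 = 0.
Proof. by rewrite /wbump_int set_itv1 Rintegral_set1. Qed.

Lemma wbump_int1 : wbump_int 1 = \int[leb]_(s in `]0, 1[) wbar_raw s.
Proof.
transitivity (\int[leb]_(s in `]0, 1[) w s); last first.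
  by apply: eq_Rintegral => x /set_mem/=; rewrite in_itv/= => x01; rewrite wbump_raw.
rewrite Rintegral_itv_bndo_bndc ?Rintegral_itv_obnd_cbnd//; exact: wbump_integrable.
Qed.

Lemma wbump_int1_gt0 : 0 < wbump_int 1.
Proof.
have l1 : 0 * (4^-1 - 0) <= wbump_int 4^-1 - wbump_int 0.
  by apply: wbump_int_ge => // x _; exact: wbump_ge0.
have l3 : 0 * (1 - 3 / 4) <= wbump_int 1 - wbump_int (3 / 4).
  apply: wbump_int_ge; [by []|lra|by move=> x _; exact: wbump_ge0].
(* On [1/4, 3/4] both 1/x and 1/(1 - x) are at most 4. *)
have l2 : expR (- 8) * (3 / 4 - 4^-1) <= wbump_int (3 / 4) - wbump_int 4^-1.
  apply: wbump_int_ge; [by []|lra|].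
  move=> x /andP[x1 x2]; have x0 : 0 < x by lra.
  have x3 : 0 < 1 - x by lra.
  rewrite /wbump /flat_pair /flat x0 x3 !expr0 !mul1r -expRD ler_expR.
  have i1 : x^-1 <= 4 by rewrite -[4]invrK lef_pV2 ?posrE ?invr_gt0.
  have i2 : (1 - x)^-1 <= 4 by rewrite -[4]invrK lef_pV2 ?posrE ?invr_gt0//; lra.
  by lra.
have := expR_gt0 (- 8 : R); move: l1 l2 l3; rewrite wbump_int0; lra.
Qed.

Lemma wbump_riemann_err N n : (0 < N)%N ->
  `|wbump_int (n%:R / N%:R) - N%:R^-1 * \sum_(i < n) w (i%:R / N%:R)| <=
  n%:R * (8 * (N%:R^-1 * N%:R^-1)).
Proof.
move=> N0; have h0 : 0 < N%:R^-1 :> R by rewrite invr_gt0 ltr0n.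
set h := N%:R^-1 in h0 *.
elim: n => [|n IH].
  by rewrite big_ord0 mulr0 !mul0r wbump_int0 subr0 normr0.
have hS : n.+1%:R * h = n%:R * h + h by rewrite -natr1 mulrDl mul1r.
have n0 : 0 <= n%:R * h by rewrite mulr_ge0// ltW.
have nS : n%:R * h <= n.+1%:R * h by rewrite hS lerDl ltW.
have B x : n%:R * h <= x <= n.+1%:R * h -> `|w x - w (n%:R * h)| <= 8 * h.
  move=> /andP[x1 x2]; rewrite (le_trans (wbump_lipschitz _ _))// ler_wpM2l//.
  by rewrite ger0_norm ?subr_ge0// lerBlDl -hS.
have H1 : (w (n%:R * h) - 8 * h) * h <= wbump_int (n.+1%:R * h) - wbump_int (n%:R * h).
  rewrite -[X in _ * X <= _](_ : n.+1%:R * h - n%:R * h = h); last by rewrite hS; ring.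
  apply: wbump_int_ge => // x /B; rewrite ler_norml => /andP[]; lra.
have H2 : wbump_int (n.+1%:R * h) - wbump_int (n%:R * h) <= (w (n%:R * h) + 8 * h) * h.
  rewrite -[X in _ <= _ * X](_ : n.+1%:R * h - n%:R * h = h); last by rewrite hS; ring.
  apply: wbump_int_le => // x /B; rewrite ler_norml => /andP[]; lra.
have e1 : n.+1%:R * (8 * (h * h)) = n%:R * (8 * (h * h)) + 8 * (h * h).
  by rewrite -natr1; ring.
rewrite big_ord_recr/= e1; move: IH H1 H2.
set A := wbump_int (n.+1%:R * h); set A' := wbump_int _; set wn := w _.
set S := \sum_(_ < _) _; set e := n%:R * _.
rewrite !ler_norml => /andP[a1 a2] a3 a4; apply/andP; split; lra.
Qed.

Definition bump_mean N : R := N%:R^-1 * \sum_(i < N) w (i%:R / N%:R).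

Lemma bump_mean_close N : (0 < N)%N -> `|wbump_int 1 - bump_mean N| <= 8 / N%:R.
Proof.
move=> N0; have := wbump_riemann_err N N0; rewrite divff ?pnatr_eq0 ?gtn_eqF//.
by rewrite (_ : _ * (8 * _) = 8 / N%:R)//; field; rewrite pnatr_eq0 gtn_eqF.
Qed.
End BumpIntegral.

(** * Characters along orbits *)

Section Characters.
Variables (R : realType) (eta : nat).
Hypothesis eta0 : (0 < eta)%N.
Implicit Types (k : nat -> int) (theta : torus R) (rho : nat -> R).

Lemma torus_coord_flow rho t theta j :
  torus_coord j (flow rho t theta) = rho j * t + torus_coord j theta -
    (Num.floor (rho j * t + torus_coord j theta))%:~R.
Proof. by []. Qed.

(** Reduction modulo 1 changes only finitely many relevant coordinates by integers,
which the character does not see. *)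
Lemma torus_char_flow k rho t theta : Zstar R eta k ->
  torus_char k (flow rho t theta) =
  e2pi (t * freq_dot k rho) * torus_char k theta.
Proof.
move=> kZ; rewrite /torus_char -e2piD.
have kJ j := @supp_bound_eq0 R eta eta0 k j kZ.
rewrite !(freq_dotE _ kJ).
(* The integer by which the reduction modulo 1 shifts k . theta. *)
pose m j : int := k j * Num.floor (rho j * t + torus_coord j theta).
rewrite (_ : \sum_(j < _) _ = t * (\sum_(j < supp_bound R eta k) (k j)%:~R * rho j) +
  \sum_(j < supp_bound R eta k) (k j)%:~R * torus_coord j theta - (\sum_(j < supp_bound R eta k) m j)%:~R).
  by rewrite [LHS]e2piD -mulrNz e2pi_int mulr1.
rewrite mulr_sumr raddf_sum -big_split/= -sumrB; apply: eq_bigr => j _.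
rewrite torus_coord_flow /m intrM; ring.
Qed.

Lemma rotation_flow rho theta : rotation rho theta = flow rho 1 theta.
Proof. by apply/funext => j; rewrite /rotation /flow mulr1 addrC. Qed.

Lemma torus_char_rotation k rho n theta : Zstar R eta k ->
  torus_char k (iter n (rotation rho) theta) =
  e2pi (freq_dot k rho) ^+ n * torus_char k theta.
Proof.
move=> kZ; elim: n => [|n IH]; first by rewrite expr0 mul1r.
by rewrite iterS rotation_flow torus_char_flow// IH mul1r mulrA -exprS.
Qed.

Lemma norm_torus_char k theta : `|torus_char k theta| = 1.
Proof. exact: norm_e2pi. Qed.

Lemma freq_dot0 (y : nat -> R) : freq_dot (fun=> 0) y = 0.
Proof. by rewrite /freq_dot fsbig1// => j _; rewrite mul0r. Qed.

Lemma torus_char0 theta : torus_char (fun=> 0) theta = 1.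
Proof. by rewrite /torus_char freq_dot0 e2pi0. Qed.

Lemma Zstar0 : Zstar R eta (fun=> 0).
Proof.
rewrite /Zstar/= /eta_norm eseries0 ?ltry// => j _ _.
by rewrite normr0 mulr0.
Qed.

End Characters.

#[local] Existing Instance totally_filter.

(** * Convergent Fourier series *)

Section FourierSums.
Variables (R : realType) (B : completeNormedModType R[i]).
Variable mu : {measure set (torus R) -> \bar R}.
Variables (eta : nat) (f : torus R -> B).
Hypothesis eta0 : (0 < eta)%N.
Hypothesis hf : fourier_space mu eta (fun x : R => expR (expR x)) f.
Local Notation fhat := (fourier_coef mu f).
Local Notation fn := (freq_norm R eta).
Implicit Types (k : nat -> int) (theta : torus R).

(** The bound of [Zstar_sum_le]; locked, as its numeral is large. *)
Definition freq_sum_const : R := locked (2 * (64 * 720 * expR 2)).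

Lemma freq_sum_const_gt0 : 0 < freq_sum_const.
Proof. by have := expR_gt0 (2 : R); rewrite /freq_sum_const -lock; lra. Qed.

Definition freq_series (c : (nat -> int) -> R[i]) : {fset (Zstar R eta)} -> B :=
  partial_sum (fun k : Zstar R eta => c (val k) *: fhat (val k)).

Lemma freq_series_cvg theta :
  freq_series (fun k => torus_char k theta) @ totally --> f theta.
Proof. by case: hf => _ + _; exact. Qed.

Lemma fourier_decay : exists2 K : R, 0 < K &
  forall k, Zstar R eta k -> k != (fun=> 0) -> bnorm (fhat k) <= K * expR (- expR (fn k)).
Proof.
case: hf => _ _ hsup; pose S := ereal_sup
  [set (expR (expR (fn k)) * bnorm (fhat k))%:E | k in Zstar R eta `\ (fun=> 0%Z)].
have Sle k : Zstar R eta k -> k != (fun=> 0) ->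
    ((expR (expR (fn k)) * bnorm (fhat k))%:E <= S)%E.
  by move=> kZ k0; apply: ereal_sup_ubound; exists k => //; split=> //; exact/eqP.
exists (Num.max 1 (fine S)); first by rewrite lt_max ltr01.
move=> k kZ k0; rewrite expRN ler_pdivlMr ?expR_gt0// mulrC.
have H := Sle k kZ k0.
rewrite le_max -lee_fin; apply/orP; right; rewrite -lee_fin fineK//.
rewrite ge0_fin_numE//; apply: le_trans H; rewrite lee_fin mulr_ge0 ?expR_ge0 ?bnorm_ge0//.
Qed.

(** Applied with c_k = 0 wherever a term must be discarded, this single estimate
bounds errors, increments and values of f. *)
Lemma freq_series_bound (c : (nat -> int) -> R[i]) (v : B) (E : R) :
  freq_series c @ totally --> v ->
  (forall k, Zstar R eta k ->
    `|c k| * (bnorm (fhat k))%:C <= (E * expR (- (2^-1 * expR (fn k))))%:C) ->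
  bnorm v <= E * freq_sum_const.
Proof.
move=> cv cE.
have kZ (k : Zstar R eta) : Zstar R eta (val k) by exact: set_valP.
have E0 : 0 <= E.
  have : 0 <= E * expR (- (2^-1 * expR (fn (fun=> 0)))).
    rewrite -ler0c; apply: le_trans (cE _ (Zstar0 R eta)).
    by rewrite mulr_ge0// ler0c bnorm_ge0.
  by rewrite pmulr_lge0// expR_gt0.
apply: (cvg_bnorm_le cv); apply: filterE => A.
rewrite /freq_series /partial_sum (le_trans (bnorm_sum _ _ _))//.
rewrite /freq_sum_const -lock.
rewrite (le_trans _ (ler_wpM2l E0 (Zstar_sum_le eta0 A)))// mulr_sumr.
apply: ler_sum => k _; rewrite -lecR -bnormE normrZ bnormE; exact: cE.
Qed.

Lemma freq_seriesD c1 c2 v1 v2 : freq_series c1 @ totally --> v1 ->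
  freq_series c2 @ totally --> v2 ->
  freq_series (fun k => c1 k + c2 k) @ totally --> v1 + v2.
Proof.
move=> h1 h2; rewrite (_ : freq_series _ = (fun A => freq_series c1 A + freq_series c2 A)).
  exact: (cvgD h1 h2).
apply/funext => A; rewrite /freq_series /partial_sum /= -big_split/=.
by apply: eq_bigr => k _; rewrite scalerDl.
Qed.

Lemma freq_seriesZ (a : R[i]) c v : freq_series c @ totally --> v ->
  freq_series (fun k => a * c k) @ totally --> a *: v.
Proof.
move=> h; rewrite (_ : freq_series _ = (fun A => a *: freq_series c A)).
  by apply: cvgZ; [exact: cvg_cst|exact: h].
apply/funext => A; rewrite /freq_series /partial_sum /= scaler_sumr.
by apply: eq_bigr => k _; rewrite scalerA.
Qed.

Lemma freq_series_sum n (c : nat -> (nat -> int) -> R[i]) (v : nat -> B) :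
  (forall i, (i < n)%N -> freq_series (c i) @ totally --> v i) ->
  freq_series (fun k => \sum_(i < n) c i k) @ totally --> \sum_(i < n) v i.
Proof.
elim: n => [|n IH] H.
  rewrite big_ord0 (_ : freq_series _ = cst 0); first exact: cvg_cst.
  apply/funext => A; rewrite /freq_series /partial_sum big1// => k _.
  by rewrite big_ord0 scale0r.
rewrite big_ord_recr/=.
rewrite (_ : (fun k => _) = (fun k => \sum_(i < n) c i k + c n k)).
  by apply: freq_seriesD; [apply: IH => i ni; apply: H; exact: ltnW|exact: H].
by apply/funext => k; rewrite big_ord_recr.
Qed.

(** The net is eventually constant: it equals the mean coefficient once the zero
frequency belongs to the finite set. *)
Lemma freq_series0 : freq_series (fun k => (k == (fun=> 0))%:R) @ totally --> fhat (fun=> 0).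
Proof.
(* The partial sums are indexed by a subtype, of which k0 is the zero element. *)
pose k0 : Zstar R eta := SigSub (mem_set (Zstar0 R eta)).
apply: cvg_near_cst; exists [fset k0]%fset => // A /fsubsetP/(_ k0).
rewrite inE eqxx => /(_ isT) kA.
rewrite /freq_series /partial_sum (bigD1 (FSetSub kA))//= eqxx scale1r big1 ?addr0// => k.
rewrite -val_eqE/= => kk0; case: eqP => [e|_]; last by rewrite scale0r.
by case/negP: kk0; apply/eqP/val_inj.
Qed.

(** The zero frequency contributes exactly the mean coefficient times the mean of the
weight, which is subtracted. *)
Lemma weighted_sum_bound (M : nat) (P : nat -> torus R) (z : (nat -> int) -> R[i])
    theta (E : R) : 0 <= E ->
  (forall k n, Zstar R eta k -> torus_char k (P n) = z k ^+ n * torus_char k theta) ->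
  (forall k, Zstar R eta k -> k != (fun=> 0) ->
    `|M%:R^-1 * \sum_(n < M) (wbump (n%:R / M%:R))%:C * z k ^+ n| * (bnorm (fhat k))%:C <=
    (E * expR (- (2^-1 * expR (fn k))))%:C) ->
  z (fun=> 0) = 1 ->
  bnorm (M%:R^-1%:C *: (\sum_(n < M) (wbump (n%:R / M%:R))%:C *: f (P n)) -
         (bump_mean R M)%:C *: fhat (fun=> 0)) <= E * freq_sum_const.
Proof.
move=> E0 Pz zE z0.
pose W k : R[i] := M%:R^-1 * \sum_(n < M) (wbump (n%:R / M%:R))%:C * z k ^+ n.
have H1 : freq_series (fun k => M%:R^-1%:C * (\sum_(n < M) (wbump (n%:R / M%:R))%:C * torus_char k (P n))
   + (- (bump_mean R M)%:C) * (k == (fun=> 0))%:R) @ totally -->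
   M%:R^-1%:C *: (\sum_(n < M) (wbump (n%:R / M%:R))%:C *: f (P n)) +
   (- (bump_mean R M)%:C) *: fhat (fun=> 0).
  apply: freq_seriesD; last exact/freq_seriesZ/freq_series0.
  apply: freq_seriesZ.
  apply: (@freq_series_sum M (fun n k => (wbump (n%:R / M%:R))%:C * torus_char k (P n))
           (fun n => (wbump (n%:R / M%:R))%:C *: f (P n))) => n _.
  exact/freq_seriesZ/freq_series_cvg.
rewrite -scaleNr; apply: freq_series_bound H1 _ => k kZ.
rewrite (_ : _ * (\sum_(_ < _) _) = W k * torus_char k theta); last first.
  rewrite /W -mulrA mulr_suml; congr (_ * _).
    by rewrite fmorphV rmorph_nat.
  by apply: eq_bigr => n _; rewrite Pz// mulrA.
have [->|k0] := eqVneq k (fun=> 0).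
  rewrite torus_char0 !mulr1 /W z0.
  under eq_bigr do rewrite expr1n mulr1.
  rewrite /bump_mean rmorphM fmorphV rmorph_nat rmorph_sum subrr normr0 mul0r.
  by rewrite lecR mulr_ge0 ?expR_ge0.
rewrite mulr0 addr0 normrM norm_torus_char mulr1; exact: zE.
Qed.

End FourierSums.

(** * Small divisors against Fourier decay *)

Section Tradeoff.
Variable R : realType.

Lemma expRN_half (y : R) : expR (- y) = expR (- (2^-1 * y)) * expR (- (2^-1 * y)).
Proof. by rewrite -expRD; congr expR; lra. Qed.

(** Write l = ln X and u = 1 / (4 eta). If x <= l / (2 eta), the bound on b provides
exp(-X^u). Otherwise one of the two factors exp(-exp(x) / 2) of exp(-exp x) does,
because exp x >= (X^u)^2 >= 2 X^u. *)
Lemma decay_tradeoff (eta : nat) (gamma l x b : R) :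
  (2 <= eta)%N -> 0 < gamma -> 4 * eta%:R <= l -> 64 / Num.sqrt gamma <= l ->
  0 <= b <= 1 ->
  (2 * eta%:R * x <= l ->
     b <= 8 * expR (- (Num.sqrt (expR l * (gamma * expR (- (eta%:R * x)))) / 8))) ->
  b * expR (- expR x) <= 8 * expR (- expR (l / (4 * eta%:R))) * expR (- (2^-1 * expR x)).
Proof.
move=> eta2 g0 l1 l2 /andP[b0 b1] Hb.
have e2 : 2 <= eta%:R :> R by rewrite ler_nat.
have e0 : 0 < eta%:R :> R by lra.
have sg0 : 0 < Num.sqrt gamma by rewrite sqrtr_gt0.
set u := expR (l / (4 * eta%:R)).
have half := expRN_half (expR x).
set h := expR (- (2^-1 * expR x)) in half *.
have h0 : 0 < h := expR_gt0 _.
have h1 : h <= 1 by rewrite expR_le1 oppr_le0 mulr_ge0// expR_ge0.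
have [lx|lx] := leP (2 * eta%:R * x) l.
  have -> : b * expR (- expR x) = (b * h) * h by rewrite half mulrA.
  rewrite (ler_wpM2r (ltW h0))//.
  rewrite (@le_trans _ _ b)//; first by rewrite ler_piMr.
  rewrite (le_trans (Hb lx))// ler_wpM2l// ler_expR lerN2.
  apply: (@le_trans _ _ (expR (l / 8))).
    rewrite ler_expR ler_pM2l; last by lra.
    by rewrite lef_pV2 ?posrE ?mulr_gt0//; lra.
  rewrite ler_pdivlMr// -[leLHS]ger0_norm ?mulr_ge0 ?expR_ge0// -sqrtr_sqr.
  rewrite ler_sqrt; last by rewrite !mulr_ge0 ?expR_ge0// ltW.
  (* This is where l >= 64 / sqrt gamma enters. *)
  have H8 : 8 <= Num.sqrt gamma * expR (l / 8).
    rewrite mulrC -ler_pdivrMr// (le_trans _ (expR_ge1Dx _))//.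
    by have := l2; rewrite !ler_pdivrMr//; lra.
  have H64 : 8 ^+ 2 <= gamma * expR (l / 8) ^+ 2.
    by rewrite -(sqr_sqrtr (ltW g0)) -exprMn lerXn2r ?nnegrE ?mulr_ge0 ?expR_ge0// ltW.
  have E1 : expR (l / 8) ^+ 2 * expR (l / 8) ^+ 2 <= expR l * expR (- (eta%:R * x)).
    rewrite -!expRM_natl -!expRD ler_expR; lra.
  rewrite exprMn.
  rewrite [leRHS]mulrCA; apply: le_trans (ler_wpM2l (ltW g0) E1).
  by rewrite [leLHS]mulrC [leRHS]mulrA ler_wpM2r// exprn_ge0// expR_ge0.
(* This is where l >= 4 eta enters. *)
have u2 : 2 <= u.
  rewrite (le_trans _ (expR_ge1Dx _))// -[2]/(1 + 1) lerD2l ler_pdivlMr ?mulr_gt0//.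
  by rewrite mul1r.
have ux : u * u <= expR x.
  rewrite -expRD ler_expR ltW//.
  have -> : l / (4 * eta%:R) + l / (4 * eta%:R) = l / (2 * eta%:R) by field; rewrite gt_eqF.
  by rewrite ltr_pdivrMr ?mulr_gt0// mulrC.
rewrite half mulrA (ler_wpM2r (ltW h0))//.
apply: (@le_trans _ _ h); first by rewrite ler_piMl// ltW.
apply: (@le_trans _ _ (expR (- u))).
  rewrite ler_expR lerN2; nra.
by rewrite ler_peMl ?expR_ge0//; lra.
Qed.

Lemma norm_weighted_mean_le1 (M : nat) (z : R[i]) : `|z| = 1 ->
  `|M%:R^-1 * \sum_(n < M) (wbump (n%:R / M%:R))%:C * z ^+ n| <= 1.
Proof.
move=> z1; have [->|M0] := posnP M; first by rewrite big_ord0 mulr0 normr0.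
rewrite normrM normfV normr_nat ler_pdivrMl ?ltr0n// mulr1.
apply: (le_trans (ler_norm_sum _ _ _)).
rewrite -[leRHS]/(M%:R : R[i]) -[X in _ <= X%:R]card_ord -sumr_const.
apply: ler_sum => n _; rewrite normrM normrX z1 expr1n mulr1 norm_real_complex.
by rewrite ger0_norm ?wbump_ge0// (lecR _ 1) wbump_le1.
Qed.

(** Translating by the nearest integer does not change the character. *)
Lemma e2pi_far (a d : R) : (forall n : int, d <= `|a - n%:~R|) ->
  d%:C <= `|1 - e2pi a|.
Proof.
move=> H; pose n := Num.floor (a + 2^-1).
have nE : e2pi a = e2pi (a - n%:~R).
  by rewrite e2piD -mulrNz e2pi_int mulr1.
rewrite nE; apply: (le_trans _ (norm_1Be2pi_ge _)); first by rewrite lecR H.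
have := floor_le (a + 2^-1); have := floorD1_gt (a + 2^-1); rewrite -/n intrD1.
by move=> h1 h2; rewrite ler_norml; apply/andP; split; lra.
Qed.

Lemma wbarE (x : R) : wbar x = (wbump_int (1 : R))^-1 * wbump x.
Proof.
rewrite /wbar; case: ifPn => [x01|]; first by rewrite wbump_int1 wbump_raw.
by rewrite negb_and -!leNgt => /orP[/wbump_le0|/wbump_ge1] ->; rewrite mulr0.
Qed.
End Tradeoff.

(** * Rates of convergence *)

Section Main.
Variables (R : realType) (B : completeNormedModType R[i]).
Variable mu : {measure set (torus R) -> \bar R}.
Variables (eta : nat) (gamma : R) (f : torus R -> B) (rho : nat -> R).
Hypotheses (eta2 : (2 <= eta)%N) (gamma0 : 0 < gamma).
Hypothesis hf : fourier_space mu eta (fun x : R => expR (expR x)) f.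
Hypothesis rho12 : forall j, 1 <= rho j <= 2.
Hypothesis hdioph : diophantine eta gamma eta%:R rho.
Let eta0 : (0 < eta)%N := ltnW eta2.
Local Notation fhat := (fourier_coef mu f).
Local Notation fn := (freq_norm R eta).
Local Notation f0 := (fhat (fun=> 0)).
Local Notation I1 := (wbump_int (1 : R)).
Implicit Types (k : nat -> int) (theta : torus R).

Variable K : R.
Hypothesis K0 : 0 < K.
Hypothesis Kd : forall k, Zstar R eta k -> k != (fun=> 0) ->
  bnorm (fhat k) <= K * expR (- expR (fn k)).

(** The zeroth character is 1, so the mean of f is its zeroth coefficient by
definition. *)
Lemma fourier_coef0 : bochner_integral mu setT f = f0.
Proof.
congr (bochner_integral mu setT _); apply/funext => theta.
rewrite /fourier_integrand (_ : (fun j => - _) = (fun=> 0)) ?torus_char0 ?scale1r//.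
Qed.

Definition rate (X : R) : R := expR (- (X `^ (4 * eta%:R)^-1)).
(** Above this value of X both X^(1/(4 eta)) >= 2 and X^(1/8) >= 8 / sqrt gamma hold. *)
Definition threshold : R := expR (Num.max (4 * eta%:R) (64 / Num.sqrt gamma)).

(** Small divisors are controlled only for frequencies with |k|_eta <= ln X / (2 eta);
for the continuous average the step T / M has to be small relative to those
frequencies, which can be arranged for frequencies of bounded norm only. *)
Lemma coef_weighted_mean_bound (X : R) (M : nat) (z : R[i]) k :
  threshold <= X -> (0 < M)%N -> `|z| = 1 -> Zstar R eta k -> k != (fun=> 0) ->
  (2 * eta%:R * fn k <= ln X ->
     (X * (gamma * expR (- (eta%:R * fn k))))%:C <= M%:R * `|1 - z|) ->
  `|M%:R^-1 * \sum_(n < M) (wbump (n%:R / M%:R))%:C * z ^+ n| * (bnorm (fhat k))%:C <=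
  (8 * K * rate X * expR (- (2^-1 * expR (fn k))))%:C.
Proof.
move=> Xt M0 z1 kZ k0 qz.
have X0 : 0 < X := lt_le_trans (expR_gt0 _) Xt.
have lX : Num.max (4 * eta%:R) (64 / Num.sqrt gamma) <= ln X.
  by rewrite -ler_expR lnK.
have := norm_weighted_mean_le1 M z1.
set W := M%:R^-1 * _; rewrite (ge0_ReE (normr_ge0 W)).
set b := complex.Re _ => b1.
have b0 : 0 <= b by rewrite -ler0c -ge0_ReE.
rewrite -rmorphM lecR.
have H : b * expR (- expR (fn k)) <=
    8 * expR (- expR (ln X / (4 * eta%:R))) * expR (- (2^-1 * expR (fn k))).
  apply: (@decay_tradeoff _ eta gamma) => //.
  - by apply: le_trans lX; rewrite le_max lexx.
  - by apply: le_trans lX; rewrite le_max lexx orbT.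
  - by rewrite b0 -lecR.
  - move=> /qz; rewrite lnK ?posrE// => q.
    set q0 := X * _ in q *.
    have q00 : 0 <= q0 by rewrite !mulr_ge0 ?expR_ge0// ltW.
    have := norm_bump_sum_exp M0 z1 q00 q.
    rewrite rmorphM rmorph_nat -ler_pdivrMl ?ltr0n//.
    rewrite -[X in X * `| _ |]ger0_norm ?invr_ge0 ?ler0n// -normrM -/W.
    by rewrite (ge0_ReE (normr_ge0 W)) lecR.
have -> : rate X = expR (- expR (ln X / (4 * eta%:R))).
  by rewrite /rate /powR gt_eqF// [_ * ln X]mulrC.
apply: (le_trans (ler_wpM2l b0 (Kd kZ k0))).
rewrite mulrCA (_ : 8 * K * _ * _ = K * (8 * expR (- expR (ln X / (4 * eta%:R))) * expR (- (2^-1 * expR (fn k))))); last by ring.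
by rewrite ler_wpM2l// ltW.
Qed.

Local Notation C0 := (freq_sum_const R).

Lemma rate_factor_ge0 X : 0 <= 8 * K * rate X.
Proof. by rewrite !mulr_ge0 ?expR_ge0// ltW. Qed.

Lemma discrete_bound (N : nat) theta : threshold <= N%:R -> (0 < N)%N ->
  bnorm (N%:R^-1%:C *: (\sum_(n < N) (wbump (n%:R / N%:R))%:C *: f (iter n (rotation rho) theta)) -
    (bump_mean R N)%:C *: f0) <= 8 * K * rate N%:R * C0.
Proof.
move=> Nt N0.
apply: (@weighted_sum_bound _ _ _ eta f eta0 hf N (fun n => iter n (rotation rho) theta)
  (fun k => e2pi (freq_dot k rho)) theta) => //.
- exact: rate_factor_ge0.
- by move=> k n kZ; exact: (torus_char_rotation eta0).
- move=> k kZ k0; apply: coef_weighted_mean_bound => //; first exact: norm_e2pi.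
  move=> _; rewrite rmorphM rmorph_nat ler_wpM2l// e2pi_far// => n.
  exact: dioph_lower.
- by rewrite freq_dot0 e2pi0.
Qed.

(** M >= 4 T ln T ensures |T/M * (k . rho)| <= 1/2 for the frequencies with
|k|_eta <= ln T / (2 eta), so that the nearest integer is 0 and the distance to it
is proportional to |k . rho|. *)
Lemma flow_bound (T : R) (M : nat) theta : threshold <= T -> (0 < M)%N ->
  4 * T * ln T <= M%:R ->
  bnorm (M%:R^-1%:C *: (\sum_(n < M) (wbump (n%:R / M%:R))%:C *: f (flow rho (n%:R * (T / M%:R)) theta)) -
    (bump_mean R M)%:C *: f0) <= 8 * K * rate T * C0.
Proof.
move=> Tt M0 MT.
have T0 : 0 < T := lt_le_trans (expR_gt0 _) Tt.
have M0' : 0 < M%:R :> R by rewrite ltr0n.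
apply: (@weighted_sum_bound _ _ _ eta f eta0 hf M (fun n => flow rho (n%:R * (T / M%:R)) theta)
  (fun k => e2pi (T / M%:R * freq_dot k rho)) theta) => //.
- exact: rate_factor_ge0.
- by move=> k n kZ; rewrite (torus_char_flow eta0)// -mulrA e2piMn.
- move=> k kZ k0; apply: coef_weighted_mean_bound => //; first exact: norm_e2pi.
  move=> kT.
  have a2 := freq_dot_le eta0 kZ rho12.
  have ag := dioph_lower eta0 0 gamma0 hdioph kZ k0; rewrite subr0 in ag.
  set a := freq_dot k rho in a2 ag *.
  have x0 : 0 <= fn k by exact: freq_norm_ge0.
  have e2 : 2 <= eta%:R :> R by rewrite ler_nat.
  have small : `|T / M%:R * a| <= 2^-1.
    rewrite normrM ger0_norm ?divr_ge0 ?(ltW T0)// mulrAC ler_pdivrMr//.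
    have : T * `|a| <= T * (2 * fn k) by rewrite ler_wpM2l// ltW.
    have : T * (2 * eta%:R * fn k) <= T * ln T by rewrite ler_wpM2l// ltW.
    have : 0 <= T * fn k * (eta%:R - 2) by rewrite !mulr_ge0 ?(ltW T0)// subr_ge0.
    lra.
  apply: le_trans (ler_wpM2l _ (norm_1Be2pi_ge small)) => //.
  rewrite -(rmorph_nat (real_complex R)) -rmorphM lecR.
  rewrite normrM ger0_norm ?divr_ge0 ?(ltW T0)//.
  have -> : M%:R * (T / M%:R * `|a|) = T * `|a| by field; rewrite gt_eqF.
  by rewrite (ler_wpM2l (ltW T0)).
- by rewrite freq_dot0 mulr0 e2pi0.
Qed.

Let C0_gt0 : 0 < C0 := freq_sum_const_gt0 R.
Let I1_gt0 : 0 < I1 := wbump_int1_gt0 R.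

(** The zero frequency is not covered by the decay condition and accounts for the
second summand of the constant. *)
Lemma fourier_space_bounded theta : bnorm (f theta) <= (K + bnorm f0 * expR 1) * C0.
Proof.
apply: (freq_series_bound eta0 (freq_series_cvg (theta := theta) hf)) => k kZ.
rewrite norm_torus_char mul1r lecR.
have [->|k0] := eqVneq k (fun=> 0).
  have -> : fn (fun=> 0) = 0.
    by rewrite /freq_norm /eta_norm eseries0// => j _ _; rewrite normr0 mulr0.
  rewrite expR0 mulr1 mulrDl -mulrA -expRD ler_wpDl ?mulr_ge0 ?expR_ge0 ?(ltW K0)//.
  rewrite ler_peMr ?bnorm_ge0//.
  by rewrite (le_trans _ (expR_ge1Dx _))//; lra.
rewrite (le_trans (Kd kZ k0))// ler_pM ?expR_ge0 ?(ltW K0)//.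
  by rewrite lerDl mulr_ge0 ?bnorm_ge0 ?expR_ge0.
rewrite ler_expR lerN2; have := expR_ge0 (fn k); lra.
Qed.

(** The k-th character varies along the flow at speed at most of order |k|_eta, a
factor absorbed by half of the double exponential decay. *)
Lemma flow_lipschitz s t theta :
  bnorm (f (flow rho s theta) - f (flow rho t theta)) <= 32 * K * `|s - t| * C0.
Proof.
have := freq_seriesD (freq_series_cvg (theta := flow rho s theta) hf)
   (freq_seriesZ (a := -1) (freq_series_cvg (theta := flow rho t theta) hf)).
rewrite scaleN1r => H; apply: (freq_series_bound eta0 H) => k kZ.
rewrite !(torus_char_flow eta0)// mulN1r -mulrBl normrM norm_torus_char mulr1.
set a := freq_dot k rho.
have -> : s * a = t * a + (s - t) * a by ring.
rewrite e2piD -[X in _ - X]mulr1 -mulrBr normrM norm_e2pi mul1r distrC.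
apply: (@le_trans _ _ ((8 * `|(s - t) * a|)%:C * (bnorm (fhat k))%:C)).
  by rewrite ler_wpM2r ?norm_1Be2pi_le// ler0c bnorm_ge0.
rewrite -rmorphM lecR.
have [k0|k0] := eqVneq k (fun=> 0).
  rewrite /a k0 freq_dot0 mulr0 normr0 mulr0 mul0r.
  by rewrite !mulr_ge0 ?expR_ge0// ltW.
have a2 := freq_dot_le eta0 kZ rho12; rewrite -/a in a2.
have x0 : 0 <= fn k := freq_norm_ge0 kZ.
apply: (@le_trans _ _ (8 * (`|s - t| * (2 * fn k)) * (K * expR (- expR (fn k))))).
  rewrite ler_pM ?bnorm_ge0 ?mulr_ge0//; last exact: Kd.
  by rewrite ler_wpM2l// normrM ler_wpM2l.
rewrite expRN_half; set h := expR (- (2^-1 * _)).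
have xh : fn k * h <= 2.
  have y0 : 0 <= 2^-1 * expR (fn k) by rewrite mulr_ge0// expR_ge0.
  have := exprM_expRN_le 1 y0; rewrite expr1 -/h => yh.
  have xe : fn k <= expR (fn k) by rewrite (le_trans _ (expR_ge1Dx _))// lerDr.
  have := ler_wpM2r (expR_ge0 (- (2^-1 * expR (fn k)))) xe; rewrite -/h.
  have -> : expR (fn k) * h = 2 * (2^-1 * expR (fn k) * h) by field.
  by rewrite (_ : 1`! = 1%N)// in yh; lra.
have -> : 8 * (`|s - t| * (2 * fn k)) * (K * (h * h)) = 16 * K * `|s - t| * h * (fn k * h) by ring.
have -> : 32 * K * `|s - t| * h = 16 * K * `|s - t| * h * 2 by ring.
by rewrite ler_wpM2l// !mulr_ge0 ?expR_ge0// ltW.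
Qed.

Lemma flow_integrand_lipschitz (T : R) theta : 0 < T ->
  exists2 L, 0 <= L & forall s t,
    bnorm (wb_flow_integrand rho T f theta s - wb_flow_integrand rho T f theta t) <= L * `|s - t|.
Proof.
move=> T0; pose Bf := (K + bnorm f0 * expR 1) * C0.
have Bf0 : 0 <= Bf.
  by rewrite mulr_ge0 ?(ltW C0_gt0)// addr_ge0 ?(ltW K0)// mulr_ge0 ?bnorm_ge0 ?expR_ge0.
have iI : 0 <= I1^-1 by rewrite invr_ge0 ltW.
exists (I1^-1 * (8 / T) * Bf + I1^-1 * (32 * K * C0)).
  have C0' := ltW C0_gt0; have K0' := ltW K0; have T0' : 0 <= T^-1 by rewrite invr_ge0 ltW.
  apply: addr_ge0; apply: mulr_ge0 => //; first by do 2! apply: mulr_ge0 => //.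
  by do 2! apply: mulr_ge0 => //.
move=> s t; rewrite /wb_flow_integrand.
set u := f _; set v := f _.
have -> : (wbar (s / T))%:C *: u - (wbar (t / T))%:C *: v =
    (wbar (s / T) - wbar (t / T))%:C *: u + (wbar (t / T))%:C *: (u - v).
  by rewrite rmorphB scalerBl scalerBr addrA subrK.
apply: (le_trans (bnormD _ _)); rewrite !bnormZ mulrDl; apply: lerD.
  rewrite [leRHS](_ : _ = I1^-1 * (8 / T) * `|s - t| * Bf); last by ring.
  apply: ler_pM; rewrite ?bnorm_ge0//; last exact: fourier_space_bounded.
  rewrite !wbarE -mulrBr normrM (ger0_norm iI) -mulrA ler_wpM2l//.
  apply: (le_trans (wbump_lipschitz _ _)).
  by rewrite -mulrBl normrM (ger0_norm (_ : 0 <= T^-1)) ?invr_ge0 ?(ltW T0)// mulrA mulrAC.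
rewrite [leRHS](_ : _ = I1^-1 * (32 * K * `|s - t| * C0)); last by ring.
apply: ler_pM; rewrite ?bnorm_ge0//; last exact: flow_lipschitz.
by rewrite wbarE normrM (ger0_norm iI) ger0_norm ?wbump_ge0// ler_piMr ?wbump_le1.
Qed.

Lemma wb_average_center N theta : (0 < N)%N -> bump_mean R N != 0 ->
  wb_average rho N f theta - f0 = (bump_mean R N)^-1%:C *:
   (N%:R^-1%:C *: (\sum_(n < N) (wbump (n%:R / N%:R))%:C *: f (iter n (rotation rho) theta)) -
    (bump_mean R N)%:C *: f0).
Proof.
move=> N0 b0; rewrite scalerBr !scalerA -!rmorphM mulVf// scale1r; congr (_ - _).
have In0 : I1 != 0 by rewrite gt_eqF.
have Nn0 : N%:R != 0 :> R by rewrite pnatr_eq0 gtn_eqF.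
rewrite /wb_average.
have -> : wb_sum N = I1^-1 * (N%:R * bump_mean R N).
  rewrite /wb_sum /bump_mean mulVKf// mulr_sumr.
  by apply: eq_bigr => n _; rewrite wbarE.
under eq_bigr do rewrite wbarE rmorphM -scalerA.
rewrite -scaler_sumr scalerA -rmorphM; congr (_ %:C *: _); field.
by rewrite Nn0 b0 In0.
Qed.

Lemma riemann_sum_center (T : R) M theta : 0 < T -> (0 < M)%N ->
  T^-1%:C *: riemann_sum (wb_flow_integrand rho T f theta) T M - f0 =
  I1^-1%:C *: (M%:R^-1%:C *:
     (\sum_(n < M) (wbump (n%:R / M%:R))%:C *: f (flow rho (n%:R * (T / M%:R)) theta)) -
     (bump_mean R M)%:C *: f0) + (I1^-1 * bump_mean R M - 1)%:C *: f0.
Proof.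
move=> T0 M0; have In0 : I1 != 0 by rewrite gt_eqF.
have Mn0 : M%:R != 0 :> R by rewrite pnatr_eq0 gtn_eqF.
have Tn0 : T != 0 by rewrite gt_eqF.
rewrite scalerBr rmorphB scalerBl !scalerA -!rmorphM rmorph1 scale1r addrA subrK; congr (_ - _).
rewrite /riemann_sum.
have -> : T^-1 * (T / M%:R) = M%:R^-1 by field; rewrite Mn0 Tn0.
rewrite [I1^-1 * _]mulrC rmorphM -scalerA; congr (_ *: _).
rewrite scaler_sumr; apply: eq_bigr => n _.
rewrite /wb_flow_integrand wbarE rmorphM -scalerA; congr (_ *: ((wbump _)%:C *: _)).
by field; rewrite Mn0 Tn0.
Qed.

Definition rate_const : R := 2 / I1 * (8 * K * C0).

Lemma rate_const_gt0 : 0 < rate_const.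
Proof. by rewrite /rate_const !mulr_gt0 ?invr_gt0. Qed.

Lemma wb_average_rate : \forall N \near \oo, forall theta,
  bnorm (wb_average rho N f theta - f0) <= rate_const * rate N%:R.
Proof.
near=> N => theta.
have N0 : (0 < N)%N by near: N; exact: nbhs_infty_gt.
have Nt : threshold <= N%:R by near: N; exact: nbhs_infty_ger.
have N8 : 16 / I1 <= N%:R by near: N; exact: nbhs_infty_ger.
have N0' : 0 < N%:R :> R by rewrite ltr0n.
(* The mean of the weight tends to I1 > 0; N >= 16 / I1 keeps it above I1 / 2. *)
have b2 : I1 / 2 <= bump_mean R N.
  have := bump_mean_close R N0; rewrite ler_norml => /andP[_].
  have : 8 / N%:R <= I1 / 2.
    by move: N8; rewrite ler_pdivrMr// ler_pdivrMr//; lra.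
  lra.
have b0 : 0 < bump_mean R N by apply: lt_le_trans b2; rewrite divr_gt0.
rewrite wb_average_center ?gt_eqF// bnormZ ger0_norm ?invr_ge0 ?(ltW b0)//.
rewrite /rate_const.
rewrite (_ : _ * _ * rate _ = 2 / I1 * (8 * K * rate N%:R * C0)); last by ring.
apply: ler_pM; rewrite ?bnorm_ge0 ?invr_ge0 ?(ltW b0)//.
  by rewrite -[2 / I1]invf_div lef_pV2 ?posrE// divr_gt0.
exact: (discrete_bound theta Nt N0).
Unshelve. all: by end_near. Qed.

(** The term I1^-1 * mean - 1 is the error of the Riemann sum of the weight; it vanishes
as the number of points grows and is absorbed by the factor 2 in the constant. *)
Lemma wb_flow_rate : \forall T \near +oo, forall theta,
  bochner_integrable lebesgue_measure `[0, T] (wb_flow_integrand rho T f theta) /\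
  bnorm (wb_flow_average rho T f theta - f0) <= rate_const * rate T.
Proof.
near=> T => theta.
have Tt : threshold <= T by near: T; apply: nbhs_pinfty_ge; exact: num_real.
have T0 : 0 < T := lt_le_trans (expR_gt0 _) Tt.
have [L L0 FL] := flow_integrand_lipschitz theta T0.
have [Fi Fc] := bochner_integral_lipschitz T0 L0 (fun s t _ _ => FL s t).
split=> //; rewrite /wb_flow_average.
have H : (fun n => T^-1%:C *: riemann_sum (wb_flow_integrand rho T f theta) T n.+1 - f0) @ \oo -->
    T^-1%:C *: bochner_integral lebesgue_measure `[0, T]%classic (wb_flow_integrand rho T f theta) - f0.
  by apply: cvgB; [apply: cvgZ; [exact: cvg_cst|exact: Fc]|exact: cvg_cst].
apply: (cvg_bnorm_le H).
set E := 8 * K * rate T * C0.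
have E0 : 0 < E by rewrite /E !mulr_gt0 ?expR_gt0.
have h1 := inv_succ_small (8 * bnorm f0) E0.
near=> n.
rewrite riemann_sum_center// (le_trans (bnormD _ _))// !bnormZ.
have iI : 0 < I1^-1 by rewrite invr_gt0.
rewrite (ger0_norm (ltW iI)).
have -> : rate_const * rate T = I1^-1 * E + I1^-1 * E by rewrite /rate_const /E; ring.
apply: lerD.
  rewrite (ler_wpM2l (ltW iI))//.
  apply: (flow_bound theta Tt) => //.
  near: n; apply: filterS (nbhs_infty_ger (4 * T * ln T)) => m hm; rewrite (le_trans hm)// ler_nat//.
have -> : I1^-1 * bump_mean R n.+1 - 1 = - (I1^-1 * (I1 - bump_mean R n.+1)).
  by field; rewrite gt_eqF.
rewrite normrN normrM (ger0_norm (ltW iI)) -mulrA (ler_wpM2l (ltW iI))//.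
apply: (@le_trans _ _ (8 / n.+1%:R * bnorm f0)).
  by rewrite ler_wpM2r ?bnorm_ge0// bump_mean_close.
rewrite mulrAC; near: n; exact: h1.
Unshelve. all: by end_near. Qed.
End Main.

Theorem corollary3p8 (R : realType) (B : completeNormedModType R[i])
    (mu : probability (torus R) R) (hmu : is_torus_measure mu)
    (eta : nat) (heta : (2 <= eta)%N)
    (gamma : R) (hgamma : 0 < gamma)
    (f : torus R -> B)
    (hf : fourier_space mu eta (fun x : R => expR (expR x)) f)
    (rho : nat -> R) (hrho : forall j, 1 <= rho j <= 2)
    (hdioph : diophantine eta gamma eta%:R rho) :
  exists upsilon C : R, [/\ 0 < upsilon, 0 < C,
    (\forall N \near \oo, forall theta : torus R,
      bnorm (wb_average rho N f theta - bochner_integral mu setT f)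
      <= C * expR (- (N%:R `^ upsilon))) &
    (\forall T \near +oo, forall theta : torus R,
      bochner_integrable lebesgue_measure `[0, T]
        (wb_flow_integrand rho T f theta) /\
      bnorm (wb_flow_average rho T f theta - bochner_integral mu setT f)
      <= C * expR (- (T `^ upsilon)))].
Proof.
have [K K0 Kd] := fourier_decay hf.
exists (4 * eta%:R)^-1, (rate_const K); split.
- by rewrite invr_gt0 mulr_gt0// ltr0n ltnW.
- exact: rate_const_gt0.
- rewrite fourier_coef0; exact: (wb_average_rate heta hgamma hf hdioph K0 Kd).
- rewrite fourier_coef0; exact: (wb_flow_rate heta hgamma hf hrho hdioph K0 Kd).
Qed.
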